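(* For all $n$ there exists $\epsilon > 0$ such that: for all $n \times n$ positive semidefinite matrices $C$ with eigenvalues $\boldsymbol{c} = (c_1,\ldots,c_n)$ such that $\operatorname{tr}(C) = n$ and $\|\boldsymbol{c} - \boldsymbol{1}\|_1 < \epsilon$, the mixed discriminant $\mathrm{MD}$ is uniquely minimized over $\mathrm{MatTup}_n(C)$ at $\frac{1}{n}(C, C, \ldots, C)$. More concretely, the result (that $\mathrm{MD}$ is uniquely minimized over $\mathrm{MatTup}_n(C)$ at $\frac{1}{n}(C,C,\ldots,C)$) holds for any $n \times n$ positive semidefinite matrix $C$ with eigenvalues $\boldsymbol{c}$ such that $\operatorname{tr}(C) = n$ and $$\frac{1}{c_1 \cdots c_n} \left(1 - \frac{\|\boldsymbol{c} - \boldsymbol{1}\|_1}{2}\right)^n > \frac{(n-1)^{2n-3}}{n^{n-1} (n-2)^{n-2}}.$$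
   Context: Positive semidefinite (PSD) matrices are Hermitian positive semidefinite matrices. $\boldsymbol{1}$ is the all-ones vector in $\mathbb{R}^n$ and $\|\boldsymbol{x}\|_1 = \sum_{i=1}^n |x_i|$. $\mathrm{MatTup}_n(C)$ is the set of $n$-tuples $(M_1,\ldots,M_n)$ of $n \times n$ PSD matrices with $\operatorname{tr}(M_i) = 1$ for all $i$ and $\sum_{i=1}^n M_i = C$. The mixed discriminant of an $n$-tuple of $n \times n$ matrices is $\mathrm{MD}(A_1,\ldots,A_n) = \frac{1}{n!}\, \partial_{x_1} \cdots \partial_{x_n} \det(x_1 A_1 + \cdots + x_n A_n)$.
   Formalization: The second part additionally assumes ‖c−1‖₁ < 2 and n ≥ 2: for even n with ‖c−1‖₁ > 2 the displayed condition can hold while the claim fails (e.g. n = 4, c = (.1,.1,1.9,1.9)), and at n = 1 the threshold is undefined. *)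

(* Defs.v *)
From HB Require Import structures.
From mathcomp Require Import all_boot all_order all_algebra.
From mathcomp Require Import sesquilinear spectral reals complex mpoly.

Set Implicit Arguments.
Unset Strict Implicit.
Unset Printing Implicit Defensive.

Import Order.TTheory GRing.Theory Num.Theory.
Local Open Scope ring_scope.
Local Open Scope sesquilinear_scope.

(* In the partial order of [C], [0 <= z] means that [z] is real and
   nonnegative. *)
Definition psdmx (C : numClosedFieldType) (n : nat) (A : 'M[C]_n) : Prop :=
  A \is hermsymmx /\
  forall x : 'cV[C]_n, 0 <= (x ^t* *m A *m x) ord0 ord0.

(* [c] lists the eigenvalues of [A] with multiplicity, in any order. *)
Definition eigenvalues (R : rcfType) (n : nat) (A : 'M[R[i]]_n)
    (c : 'rV[R]_n) : Prop :=
  char_poly A = \prod_(i < n) ('X - ((c ord0 i)%:C)%C%:P).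

Definition norm1 (R : numDomainType) (n : nat) (x : 'rV[R]_n) : R :=
  \sum_(i < n) `|x ord0 i|.

Definition MatTup (C : numClosedFieldType) (n : nat) (A : 'M[C]_n)
    (M : {ffun 'I_n -> 'M[C]_n}) : Prop :=
  (forall i, psdmx (M i) /\ \tr (M i) = 1) /\ \sum_(i < n) M i = A.

(* [\det (\sum_i x_i A_i)] is homogeneous of degree [n] in [n] variables, so
   its derivative once in each variable is a constant polynomial; evaluating
   it at [0] turns it into a scalar. *)
Definition MD (C : numFieldType) (n : nat) (A : {ffun 'I_n -> 'M[C]_n}) : C :=
  let p : {mpoly C[n]} :=
    \det (\sum_(i < n) 'X_i *: map_mx (@mpolyC n C) (A i)) in
  (n`!%:R)^-1 * (foldr (fun i q => q^`M(i)) p (enum 'I_n)).@[fun _ => 0].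

Definition uniquely_minimized_at (T : Type) (C : numDomainType) (f : T -> C)
    (S : T -> Prop) (x0 : T) : Prop :=
  [/\ S x0,
      forall x, S x -> f x0 <= f x
    & forall x, S x -> f x = f x0 -> x = x0].

(* Main.v *)
From mathcomp Require Import all_fingroup.
Require Import Defs.
From mathcomp Require Import all_boot all_order all_algebra.
From mathcomp Require Import reals complex.
From mathcomp Require Import sesquilinear spectral ring lra.
From mathcomp Require boolp classical_sets functions topology normedtype derive.
From mathcomp Require mpoly.

Set Implicit Arguments.
Unset Strict Implicit.
Unset Printing Implicit Defensive.

Import Order.TTheory GRing.Theory Num.Theory.
Local Open Scope ring_scope.

(** Tuples with prescribed sum form a compact set, so the mixed discriminant
    has a minimizer ([Compactness.minimizer_exists]).  The centre is found by
    excluding every other tuple, in two steps.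

    Tuples containing a singular matrix are too expensive
    ([singular_gt_center]).  The mixed discriminant of [A] is, up to [n`!], the
    derivative once in each variable of [p x = \det (\sum_i x_i *: A_i)].
    Gurvits' inequality says that differentiating in a variable of degree at
    most [d] and then setting it to zero multiplies the capacity, the infimum of
    [p x / \prod_i x_i] over positive [x], by at least
    [gurvits d = ((d - 1) / d) ^ (d - 1)].  It is AM-GM applied to the roots of
    a univariate restriction ([gurvits_step]); these roots remain real and
    negative because a form of stability survives the derivatives
    ([strictly_stable_mderiv]).  Over all variables the factors multiply to
    [n`! / n ^ n], but a singular [A_i] makes the degree in its variable at most
    [n - 1], which improves the bound by [gurvits (n - 1) / gurvits n]
    ([mixdet_singular_ge]).  The capacity of [p] is itself at least
    [(1 - |c - 1| / 2) ^ n] ([det_capacity]): in an eigenbasis of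
    [\sum_i x_i *: A_i] the determinant is a product of linear forms in [x]
    whose matrix has column sums [1] and row sums close to [1].  The criterion
    on the eigenvalues states that the resulting bound exceeds the value
    [\det C / n ^ n] at the centre.

    So a minimizer consists of positive definite matrices.  If two of them, in
    slots [i] and [j], differ, move a multiple [s] of their difference from one
    slot to the other.  The mixed discriminant is quadratic in [s] and, by
    symmetry, takes the same value at [0] and [1]; being minimal at the
    interior point [0] it is constant.  Following the line until one of the two
    matrices becomes singular yields a singular minimizer, which was excluded
    ([minimizer_constant]).  Hence all the matrices of a minimizer are equal.

    For eigenvalues close to [1] the criterion holds because its right-hand
    side [gurvits n / gurvits (n - 1)] is below [1] ([gurvits_decreasing]). *)

(** * Positive semidefinite matrices *)

Section PSD.
Local Open Scope sesquilinear_scope.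
Variables (C : numClosedFieldType) (n : nat).
Implicit Types (A B H M P : 'M[C]_n) (x : 'cV[C]_n) (d : 'rV[C]_n).

Lemma hermsymmxE A : (A \is hermsymmx) = (A^t* == A).
Proof. by rewrite is_hermitianmxE expr0 scale1r eq_sym. Qed.

Lemma hermsymmxP A : reflect (A^t* = A) (A \is hermsymmx).
Proof. by rewrite hermsymmxE; apply: eqP. Qed.

Lemma conjtmxM m p q (A : 'M[C]_(m, p)) (B : 'M[C]_(p, q)) :
  (A *m B)^t* = B^t* *m A^t*.
Proof. by rewrite trmx_mul map_mxM. Qed.

Lemma conjtmxD m p (A B : 'M[C]_(m, p)) : (A + B)^t* = A^t* + B^t*.
Proof. by rewrite linearD map_mxD. Qed.

Lemma hermsymmxD A B : A \is hermsymmx -> B \is hermsymmx ->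
  A + B \is hermsymmx.
Proof. by rewrite !hermsymmxE conjtmxD => /eqP-> /eqP->. Qed.

Lemma hermsymmxZ a A : a \is Num.real -> A \is hermsymmx ->
  a *: A \is hermsymmx.
Proof.
move=> /CrealP ar; rewrite !hermsymmxE => /eqP hA; apply/eqP.
by apply/matrixP => i j; rewrite -{2}hA !mxE rmorphM /= ar.
Qed.

Lemma hermsymmxB A B : A \is hermsymmx -> B \is hermsymmx ->
  A - B \is hermsymmx.
Proof.
move=> hA hB; apply: hermsymmxD => //; rewrite -scaleN1r.
by apply: hermsymmxZ; rewrite ?realN ?real1.
Qed.

Lemma diag_hermsymmx d : (forall k, d 0 k \is Num.real) ->
  diag_mx d \is hermsymmx.
Proof.
move=> dr; apply/hermsymmxP/matrixP=> i j; rewrite !mxE eq_sym.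
have [->|] := eqVneq i j; last by rewrite !mulr0n rmorph0.
by rewrite !mulr1n; apply/CrealP.
Qed.

Lemma congr_hermsymmx P A : A \is hermsymmx ->
  P^t* *m A *m P \is hermsymmx.
Proof.
by rewrite !hermsymmxE !conjtmxM trmxCK => /eqP ->; rewrite mulmxA.
Qed.

Lemma congr_psdmx P A : psdmx A -> psdmx (P^t* *m A *m P).
Proof.
case=> hA pA; split; first exact: congr_hermsymmx.
by move=> x; have := pA (P *m x); rewrite conjtmxM !mulmxA.
Qed.

Lemma diag_psdmx d : (forall k, 0 <= d 0 k) -> psdmx (diag_mx d).
Proof.
move=> d0; split; first by apply: diag_hermsymmx => k; apply: ger0_real.
move=> x; rewrite mul_mx_diag !mxE; apply: sumr_ge0 => k _; rewrite !mxE.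
by rewrite mulrAC mulrC mulr_ge0 // mulrC -normCK exprn_ge0.
Qed.

Lemma psdmxD A B : psdmx A -> psdmx B -> psdmx (A + B).
Proof.
move=> [hA pA] [hB pB]; split; first exact: hermsymmxD.
by move=> x; rewrite mulmxDr mulmxDl mxE addr_ge0.
Qed.

Lemma psdmxZ a A : 0 <= a -> psdmx A -> psdmx (a *: A).
Proof.
move=> a0 [hA pA]; split; first by apply: hermsymmxZ => //; apply: ger0_real.
by move=> x; rewrite -scalemxAr -scalemxAl mxE mulr_ge0.
Qed.

Lemma psdmx0 : psdmx (0 : 'M[C]_n).
Proof.
have <- : diag_mx (0 : 'rV[C]_n) = 0 by rewrite linear0.
by apply: diag_psdmx => k; rewrite mxE.
Qed.

Lemma psdmx1 : psdmx (1%:M : 'M[C]_n).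
Proof.
by rewrite -diag_const_mx; apply: diag_psdmx => k; rewrite mxE ler01.
Qed.

Lemma psdmx_sum (I : Type) (r : seq I) (Q : pred I) (F : I -> 'M[C]_n) :
  (forall i, Q i -> psdmx (F i)) -> psdmx (\sum_(i <- r | Q i) F i).
Proof. by move=> h; elim/big_ind: _ => //; [apply: psdmx0|apply: psdmxD]. Qed.

Lemma psdmx_diag_ge0 A k : psdmx A -> 0 <= A k k.
Proof.
case=> _ /(_ (delta_mx k 0)); congr (_ <= _).
have -> : (delta_mx k 0 : 'cV[C]_n)^t* = delta_mx 0 k.
  by apply/matrixP=> i j; rewrite !mxE andbC; case: (_ && _); rewrite ?rmorph0 ?rmorph1.
by rewrite -rowE -colE !mxE.
Qed.

Lemma hermsymmx_spectral A : A \is hermsymmx ->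
  exists U d, [/\ U \is unitarymx, (forall k, d 0 k \is Num.real)
    & A = U^t* *m diag_mx d *m U].
Proof.
move=> hA; exists (spectralmx A), (spectral_diag A); split.
- exact: spectral_unitarymx.
- by move=> k; apply: (mxOverP (hermitian_spectral_diag_real hA)).
- rewrite -invmx_unitary ?spectral_unitarymx //.
  exact/orthomx_spectralP/hermitian_normalmx.
Qed.

Lemma congrK P A : P \in unitmx ->
  (invmx P)^t* *m (P^t* *m A *m P) *m invmx P = A.
Proof.
move=> uP; rewrite !mulmxA mulmxK // -conjtmxM mulmxV //.
by rewrite trmx1 map_mx1 mul1mx.
Qed.

Lemma congrVK P A : P \in unitmx ->
  P^t* *m ((invmx P)^t* *m A *m invmx P) *m P = A.
Proof.
move=> uP; rewrite !mulmxA mulmxKV // -conjtmxM mulVmx //.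
by rewrite trmx1 map_mx1 mul1mx.
Qed.

Lemma psdmx_congr_diag P d : P \in unitmx ->
  psdmx (P^t* *m diag_mx d *m P) -> forall k, 0 <= d 0 k.
Proof.
move=> uP pA k; have := congr_psdmx (invmx P) pA.
by rewrite congrK // => /(psdmx_diag_ge0 k); rewrite mxE eqxx mulr1n.
Qed.

Lemma psdmx_spectral A : psdmx A ->
  exists U d, [/\ U \is unitarymx, (forall k, 0 <= d 0 k)
    & A = U^t* *m diag_mx d *m U].
Proof.
move=> pA; have [U [d [uU _ eA]]] := hermsymmx_spectral pA.1.
exists U, d; split=> //; apply: (psdmx_congr_diag (unitarymx_unit uU)).
by rewrite -eA.
Qed.

Lemma det_congr_diag P d :
  \det (P^t* *m diag_mx d *m P) = `|\det P| ^+ 2 * \prod_k d 0 k.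
Proof.
rewrite !det_mulmx det_diag det_map_mx det_tr normCK.
by rewrite [_ * (\det P)^*]mulrC mulrAC.
Qed.

Lemma psdmx_det_ge0 A : psdmx A -> 0 <= \det A.
Proof.
move=> /psdmx_spectral[U [d [_ d0 ->]]].
by rewrite det_congr_diag mulr_ge0 ?exprn_ge0 // prodr_ge0.
Qed.

Lemma posdef_factor A : psdmx A -> \det A != 0 ->
  exists2 P, P \in unitmx & A = P^t* *m P.
Proof.
move=> /psdmx_spectral[U [d [uU d0 ->]]] dA.
pose D := diag_mx (\row_k sqrtC (d 0 k)) : 'M[C]_n.
have eD : diag_mx d = D^t* *m D.
  have /hermsymmxP-> : D \is hermsymmx.
    by apply: diag_hermsymmx => k; rewrite mxE ger0_real // sqrtC_ge0.
  rewrite mul_diag_mx; apply/matrixP=> i j; rewrite !mxE.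
  by case: eqP => [->|_]; rewrite ?mulr0n ?mulr0 // !mulr1n -expr2 sqrtCK.
exists (D *m U); last by rewrite conjtmxM eD !mulmxA.
have : D^t* *m D \in unitmx.
  rewrite -eD unitmxE det_diag unitfE; apply: contraNneq dA => p0.
  by rewrite det_congr_diag p0 mulr0.
by rewrite !unitmx_mul => /andP[_ ->]; rewrite unitarymx_unit.
Qed.

(** Whitening by a positive definite [A] turns the pencil [A, H] into a
    diagonal one, so that every determinant below factors over the reals. *)
Lemma simultaneous_diag A H : psdmx A -> \det A != 0 -> H \is hermsymmx ->
  exists P d, [/\ P \in unitmx, (forall k, d 0 k \is Num.real),
    A = P^t* *m P & H = P^t* *m diag_mx d *m P].
Proof.
move=> pA dA hH; have [Q uQ eA] := posdef_factor pA dA.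
have hH' := congr_hermsymmx (invmx Q) hH.
have [U [d [uU dr eH]]] := hermsymmx_spectral hH'.
exists (U *m Q), d; split=> //.
- by rewrite unitmx_mul unitarymx_unit.
- rewrite conjtmxM mulmxA -(mulmxA (Q^t*)) -invmx_unitary //.
  by rewrite mulVmx ?unitarymx_unit // mulmx1.
- by rewrite conjtmxM -[LHS](congrVK _ uQ) eH !mulmxA.
Qed.

Lemma pencilE P d a b :
  a *: (P^t* *m P) + b *: (P^t* *m diag_mx d *m P) =
  P^t* *m diag_mx (\row_k (a + b * d 0 k)) *m P.
Proof.
have -> : diag_mx (\row_k (a + b * d 0 k)) = a%:M + b *: diag_mx d.
  by apply/matrixP=> i j; rewrite !mxE; case: eqP; rewrite ?mulr1n ?mulr0n ?mulr0 ?addr0.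
by rewrite mulmxDr mulmxDl mul_mx_scalar -!scalemxAl -scalemxAr -scalemxAl.
Qed.

Lemma det_pencil P d a b :
  \det (a *: (P^t* *m P) + b *: (P^t* *m diag_mx d *m P)) =
  `|\det P| ^+ 2 * \prod_k (a + b * d 0 k).
Proof.
by rewrite pencilE det_congr_diag; congr (_ * _); apply: eq_bigr => k; rewrite mxE.
Qed.

Lemma normdet2_gt0 P : P \in unitmx -> 0 < `|\det P| ^+ 2.
Proof. by rewrite unitmxE unitfE => dP; rewrite exprn_gt0 // normr_gt0. Qed.

Lemma posdef_det_gt0 A : psdmx A -> \det A != 0 -> 0 < \det A.
Proof. by move=> pA dA; rewrite lt_def dA psdmx_det_ge0. Qed.

Lemma le_det_psdmxD A B : psdmx A -> \det A != 0 -> psdmx B ->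
  \det A <= \det (A + B).
Proof.
move=> pA dA pB; have [P [d [uP _ eA eB]]] := simultaneous_diag pA dA pB.1.
have d0 : forall k, 0 <= d 0 k by apply: (psdmx_congr_diag uP); rewrite -eB.
have dE a : \det (A + a *: B) = `|\det P| ^+ 2 * \prod_k (1 + a * d 0 k).
  by rewrite -[A]scale1r eA eB det_pencil.
have := dE 0; rewrite scale0r addr0 => ->; have := dE 1; rewrite scale1r => ->.
apply: ler_wpM2l; first exact: exprn_ge0.
by apply: ler_prod => k _; rewrite mul0r addr0 ler01 mul1r lerDl /=.
Qed.

Lemma posdefD A B : psdmx A -> \det A != 0 -> psdmx B -> \det (A + B) != 0.
Proof.
move=> pA dA pB; apply: lt0r_neq0; apply: lt_le_trans (le_det_psdmxD pA dA pB).
exact: posdef_det_gt0.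
Qed.

(** Relative to a definite [A], the Hermitian [H] has real eigenvalues [d k],
    and [d k + 'i] is never zero. *)
Lemma det_upper_neq0 A H : psdmx A -> \det A != 0 -> H \is hermsymmx ->
  \det (H + 'i *: A) != 0.
Proof.
move=> pA dA hH; have [P [d [uP dr eA eH]]] := simultaneous_diag pA dA hH.
rewrite addrC -[H]scale1r {1}eA eH det_pencil.
apply: mulf_neq0; first exact/lt0r_neq0/normdet2_gt0.
apply/prodf_neq0 => k _; rewrite mul1r addrC -[X in _ + X]mulr1.
by apply/eqP=> /(congr1 (@Im C)); rewrite Im_rect ?real1 // raddf0 => /eqP; rewrite oner_eq0.
Qed.

Lemma psdmx_tr0 A : psdmx A -> \tr A = 0 -> A = 0.
Proof.
move=> /psdmx_spectral[U [d [uU d0 ->]]].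
rewrite mxtrace_mulC mulmxA -invmx_unitary // mulmxV ?unitarymx_unit //.
rewrite mul1mx mxtrace_diag => /eqP; rewrite psumr_eq0 // => /allP dz.
suff -> : d = 0 by rewrite linear0 mulmx0 mul0mx.
by apply/rowP=> k; rewrite mxE; apply/eqP/dz/mem_index_enum.
Qed.

(** Moving from a positive definite matrix in a direction that is not
    positive semidefinite, one leaves the cone through a singular matrix: in
    the common diagonalisation this happens when the entry with the most
    negative slope reaches zero. *)
Lemma psdmx_exit A H : psdmx A -> \det A != 0 -> H \is hermsymmx ->
  ~ psdmx H -> exists s, [/\ 0 < s, psdmx (A + s *: H) & \det (A + s *: H) = 0].
Proof.
move=> pA dA hH npH; have [P [d [uP dr eA eH]]] := simultaneous_diag pA dA hH.
have [k0 dk0] : exists k0, d 0 k0 < 0.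
  apply/existsP; apply: contra_notT npH; rewrite negb_exists => /forallP d0.
  rewrite eH; apply: congr_psdmx; apply: diag_psdmx => k.
  by have := d0 k; rewrite -real_leNgt ?real0.
have [k1 k1P] : exists k1, forall k, d 0 k1 <= d 0 k.
  have : exists k1, k1 \in enum 'I_n /\ forall k, k \in enum 'I_n -> d 0 k1 <= d 0 k.
    have : k0 \in enum 'I_n by rewrite mem_enum.
    elim: (enum 'I_n) (k0) => // a r IH b _.
    have [->|rn] := eqVneq r [::].
      by exists a; split; [rewrite mem_head|move=> k; rewrite inE => /eqP->].
    have [c [cr cP]] : exists k1, k1 \in r /\ forall k, k \in r -> d 0 k1 <= d 0 k.
      by case: r rn IH => // c r _ /(_ c); apply; rewrite mem_head.
    case: (real_leP (dr a) (dr c)) => [ac|ca].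
      exists a; split=> [|k]; first by rewrite mem_head.
      by rewrite inE => /predU1P[->//|/cP]; apply: le_trans.
    exists c; split=> [|k]; first by rewrite inE cr orbT.
    by rewrite inE => /predU1P[->|/cP//]; apply: ltW.
  by case=> k1 [_ k1P]; exists k1 => k; apply: k1P; rewrite mem_enum.
have dk1 : d 0 k1 < 0 by apply: le_lt_trans dk0.
have E s : A + s *: H = P^t* *m diag_mx (\row_k (1 + s * d 0 k)) *m P.
  by rewrite -pencilE -eA -eH scale1r.
exists (- (d 0 k1)^-1); split; first by rewrite oppr_gt0 invr_lt0.
- rewrite E; apply: congr_psdmx; apply: diag_psdmx => k; rewrite mxE mulNr subr_ge0.
  by rewrite mulrC ler_ndivrMr // mul1r.
- rewrite E det_congr_diag (bigD1 k1) //= mxE mulNr mulVf ?lt_eqF //.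
  by rewrite subrr mul0r mulr0.
Qed.

End PSD.

Section Unitary.
Local Open Scope sesquilinear_scope.
Variables (C : numClosedFieldType) (n : nat).
Implicit Types (U V : 'M[C]_n).

Lemma unitary_row_norm U j : U \is unitarymx -> \sum_k `|U j k| ^+ 2 = 1.
Proof.
move=> /unitarymxP /matrixP /(_ j j); rewrite !mxE eqxx mulr1n => <-.
by apply: eq_bigr => k _; rewrite !mxE normCK.
Qed.

Lemma unitary_col_norm U k : U \is unitarymx -> \sum_j `|U j k| ^+ 2 = 1.
Proof.
rewrite -trmxC_unitary => /(unitary_row_norm k) <-.
by apply: eq_bigr => j _; rewrite !mxE norm_conjC.
Qed.

(** The diagonal entries of a unitary conjugate are averages of the [l k], and
    over any set of rows each [l k] has total weight at most one; so the
    deficit is at most the sum of the positive parts of [1 - l k].  As the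
    [1 - l k] sum to zero, that is half their norm. *)
Lemma unitary_diag_deficit U (l : 'rV[C]_n) (P : pred 'I_n) :
  U \is unitarymx -> (forall k, l 0 k \is Num.real) -> \sum_k l 0 k = n%:R ->
  \sum_(j | P j) (1 - (U *m diag_mx l *m U^t*) j j) <=
    (\sum_k `|l 0 k - 1|) / 2.
Proof.
move=> uU lr sl; pose w k := \sum_(j | P j) `|U j k| ^+ 2.
have w0 k : 0 <= w k by apply: sumr_ge0 => j _; rewrite exprn_ge0.
have w1 k : w k <= 1.
  rewrite -(unitary_col_norm k uU) [X in _ <= X](bigID P) /= lerDl sumr_ge0 //.
  by move=> j _; rewrite exprn_ge0.
have -> : \sum_(j | P j) (1 - (U *m diag_mx l *m U^t*) j j) =
    \sum_k w k * (1 - l 0 k).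
  under [RHS]eq_bigr do rewrite mulr_suml.
  rewrite [RHS]exchange_big; apply: eq_bigr => j _ /=.
  under [RHS]eq_bigr do rewrite mulrBr mulr1.
  rewrite sumrB (unitary_row_norm _ uU); congr (_ - _); rewrite mul_mx_diag !mxE.
  by apply: eq_bigr => k _; rewrite !mxE normCK mulrAC.
have -> : (\sum_k `|l 0 k - 1|) / 2 = \sum_k (`|l 0 k - 1| + (1 - l 0 k)) / 2.
  rewrite -mulr_suml big_split /= sumrB sl sumr_const card_ord subrr.
  by rewrite addr0.
apply: ler_sum => k _; rewrite ler_pdivlMr ?ltr0n // distrC.
have tr : 1 - l 0 k \is Num.real by rewrite realB ?real1.
case: (real_ge0P tr) => [t0|t0].
  by rewrite -mulr2n -[X in _ <= X]mulr_natr ler_wpM2r // ler_piMl.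
by rewrite addNr mulr_le0_ge0 // mulr_ge0_le0 // ltW.
Qed.

Lemma psdmx_entry_le (A : 'M[C]_n) i j :
  psdmx A -> `|A i j| <= \tr A.
Proof.
move=> /psdmx_spectral[U [d [uU d0 ->]]].
rewrite mxtrace_mulC mulmxA -{2}invmx_unitary // mulmxV ?unitarymx_unit //.
rewrite mul1mx mxtrace_diag -mulmxA mul_diag_mx mxE.
have U1 k l : `|U k l| <= 1.
  rewrite -(@expr_le1 _ 2) // -(unitary_col_norm l uU) (bigD1 k) //= lerDl.
  by rewrite sumr_ge0 // => m _; rewrite exprn_ge0.
apply: le_trans (ler_norm_sum _ _ _) _; apply: ler_sum => k _.
rewrite !mxE normrM norm_conjC normrM (ger0_norm (d0 k)) mulrCA ler_piMr //.
by rewrite mulr_ile1.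
Qed.

End Unitary.

(** * Mixed determinants *)

Section MixedDeterminant.
Variables (F : comNzRingType) (n : nat).
Implicit Types (A : 'I_n -> 'M[F]_n).

(** This is [n`!] times the mixed discriminant ([MDE]), in a form that shows
    multilinearity and symmetry. *)
Definition mixdet A : F :=
  \sum_(t : {perm 'I_n}) \det (\matrix_(i, j) A (t i) i j).

Lemma mixdet_perm A (s : {perm 'I_n}) : mixdet (A \o s) = mixdet A.
Proof.
rewrite /mixdet (reindex_inj (mulIg s^-1%g)) /=; apply: eq_bigr => t _.
by congr (\det _); apply/matrixP=> i j; rewrite !mxE /= permM permKV.
Qed.

Definition update_mx A i X j : 'M[F]_n := if j == i then X else A j.

Lemma mixdet_linear A i a b X Y :
  mixdet (update_mx A i (a *: X + b *: Y)) =
  a * mixdet (update_mx A i X) + b * mixdet (update_mx A i Y).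
Proof.
rewrite /mixdet !mulr_sumr -big_split; apply: eq_bigr => t _ /=.
have ti : t (t^-1%g i) = i by rewrite permKV.
apply: (@determinant_multilinear _ _ _ _ _ (t^-1%g i)).
- by apply/rowP=> j; rewrite !mxE /update_mx ti eqxx !mxE.
- apply/matrixP => k j; rewrite !mxE /update_mx ifN ?ifN //.
    by rewrite -{2}ti (inj_eq perm_inj) eq_sym neq_lift.
  by rewrite -{2}ti (inj_eq perm_inj) eq_sym neq_lift.
- apply/matrixP => k j; rewrite !mxE /update_mx ifN ?ifN //.
    by rewrite -{2}ti (inj_eq perm_inj) eq_sym neq_lift.
  by rewrite -{2}ti (inj_eq perm_inj) eq_sym neq_lift.
Qed.

Lemma eq_mixdet A B : A =1 B -> mixdet A = mixdet B.
Proof.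
move=> e; apply: eq_bigr => t _; congr (\det _); apply/matrixP => i j.
by rewrite !mxE e.
Qed.

Lemma mixdet_const X : mixdet (fun _ => X) = n`!%:R * \det X.
Proof.
rewrite /mixdet (eq_bigr (fun _ => \det X)) => [|t _].
  by rewrite sumr_const card_Sn mulr_natl.
by congr (\det _); apply/matrixP=> i j; rewrite mxE.
Qed.

(** This lets singular tuples be reached as limits of positive definite ones. *)
Lemma mixdet_poly A B :
  exists p : {poly F}, forall e, p.[e] = mixdet (fun i => A i + e *: B i).
Proof.
exists (\sum_(t : {perm 'I_n}) \det (\matrix_(i, j)
  ((A (t i) i j)%:P + (B (t i) i j) *: 'X))) => e.
rewrite horner_sum; apply: eq_bigr => t _; rewrite -horner_evalE -det_map_mx.
congr (\det _); apply/matrixP => i j; rewrite !mxE /= horner_evalE !hornerE.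
by rewrite mulrC.
Qed.

End MixedDeterminant.

(** * Existence of minimizers *)

Module Compactness.
Import boolp classical_sets functions topology normedtype derive.
Import numFieldNormedType.Exports.
Local Open Scope sesquilinear_scope.

Section ComplexContinuity.
Variables (R : realType) (K : topologicalType).
Implicit Types (f g : K -> R[i]).

(** Continuity in the two real coordinates is what makes order and equality
    conditions between complex expressions closed. *)
Definition ccont f :=
  continuous (fun v => complex.Re (f v) : R) /\
  continuous (fun v => complex.Im (f v) : R).

Lemma ccont_cst c : ccont (fun _ => c).
Proof. by split; apply: cst_continuous. Qed.

Lemma ccontD f g : ccont f -> ccont g -> ccont (fun v => f v + g v).
Proof.
move=> [f1 f2] [g1 g2]; split=> v.
- have -> : (fun v => complex.Re (f v + g v)) =
    (fun v => complex.Re (f v) + complex.Re (g v)).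
    by apply: funext => u; case: (f u) (g u) => [? ?] [? ?].
  by apply: continuousD; [apply: f1|apply: g1].
- have -> : (fun v => complex.Im (f v + g v)) =
    (fun v => complex.Im (f v) + complex.Im (g v)).
    by apply: funext => u; case: (f u) (g u) => [? ?] [? ?].
  by apply: continuousD; [apply: f2|apply: g2].
Qed.

Lemma ccontM f g : ccont f -> ccont g -> ccont (fun v => f v * g v).
Proof.
move=> [f1 f2] [g1 g2]; split=> v.
- have -> : (fun v => complex.Re (f v * g v)) =
    (fun v => complex.Re (f v) * complex.Re (g v) - complex.Im (f v) * complex.Im (g v)).
    by apply: funext => u; case: (f u) (g u) => [? ?] [? ?].
  apply: cvgB; apply: continuousM;
    by [apply: f1|apply: g1|apply: f2|apply: g2].
- have -> : (fun v => complex.Im (f v * g v)) =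
    (fun v => complex.Re (f v) * complex.Im (g v) + complex.Im (f v) * complex.Re (g v)).
    by apply: funext => u; case: (f u) (g u) => [? ?] [? ?].
  apply: cvgD; apply: continuousM;
    by [apply: f1|apply: g1|apply: f2|apply: g2].
Qed.

Lemma ccontB f g : ccont f -> ccont g -> ccont (fun v => f v - g v).
Proof.
move=> cf cg; have -> : (fun v => f v - g v) = (fun v => f v + (-1) * g v).
  by apply: funext => v; rewrite mulN1r.
by apply: ccontD => //; apply: ccontM => //; apply: ccont_cst.
Qed.

Lemma ccont_conj f : ccont f -> ccont (fun v => (f v)^*).
Proof.
move=> [f1 f2]; split=> v.
- have -> : (fun v => complex.Re (f v)^*) = (fun v => complex.Re (f v)).
    by apply: funext => u; case: (f u).
  exact: f1.
- have -> : (fun v => complex.Im (f v)^*) = (fun v => - complex.Im (f v)).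
    by apply: funext => u; case: (f u).
  by apply: continuousN; apply: f2.
Qed.

Lemma ccont_sum (I : Type) (r : seq I) (P : pred I) (F : I -> K -> R[i]) :
  (forall i, ccont (F i)) -> ccont (fun v => \sum_(i <- r | P i) F i v).
Proof.
move=> cF; elim: r => [|i r IH].
  by under [X in ccont X]funext do rewrite big_nil; apply: ccont_cst.
under [X in ccont X]funext do rewrite big_cons.
by case: (P i) => //; apply: ccontD.
Qed.

Lemma ccont_prod (I : Type) (r : seq I) (P : pred I) (F : I -> K -> R[i]) :
  (forall i, ccont (F i)) -> ccont (fun v => \prod_(i <- r | P i) F i v).
Proof.
move=> cF; elim: r => [|i r IH].
  by under [X in ccont X]funext do rewrite big_nil; apply: ccont_cst.
under [X in ccont X]funext do rewrite big_cons.
by case: (P i) => //; apply: ccontM.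
Qed.

Lemma closed_ccont_ge0 f : ccont f -> closed [set v | 0 <= f v]%classic.
Proof.
move=> [f1 f2].
have -> : [set v | 0 <= f v]%classic =
    ((fun v => complex.Im (f v)) @^-1` [set x | x = 0] `&`
     (fun v => complex.Re (f v)) @^-1` [set x | 0 <= x])%classic.
  apply/seteqP; split=> v /=; rewrite lecE /=.
    by move=> /andP[/eqP].
  by case=> -> ->; rewrite eqxx.
apply: closedI.
- by move/continuous_closedP : f2; apply; apply: closed_eq.
- by move/continuous_closedP : f1; apply; apply: closed_ge.
Qed.

Lemma closed_ccont_eq f g : ccont f -> ccont g ->
  closed [set v | f v = g v]%classic.
Proof.
move=> cf cg.
have -> : [set v | f v = g v]%classic =
    ([set v | 0 <= f v - g v]%R `&` [set v | 0 <= g v - f v]%R)%classic.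
  apply/seteqP; split=> v /=; first by move=> ->; rewrite subrr.
  by rewrite !subr_ge0 => -[gf fg]; apply: le_anti; rewrite gf fg.
by apply: closedI; apply: closed_ccont_ge0; apply: ccontB.
Qed.

Lemma closed_forall (I : Type) (P : I -> K -> Prop) :
  (forall i, closed [set v | P i v]%classic) ->
  closed [set v | forall i, P i v]%classic.
Proof.
move=> cP; have -> : [set v | forall i, P i v]%classic =
    (\bigcap_i [set v | P i v])%classic.
  apply/seteqP; split=> v h i; first by move=> _; apply: h.
  exact: (h i Logic.I).
exact: closed_bigI.
Qed.

End ComplexContinuity.

Section Minimizer.
Variables (R : realType) (n : nat) (M : 'M[R[i]]_n).

Definition coord : Type := ('I_n * ('I_n * 'I_n) * bool)%type.
(** Tuples of matrices are points of a power of [R], whose bounded closed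
    boxes are compact by Tychonoff's theorem. *)
Definition space : topologicalType := prod_topology (fun _ : coord => R : topologicalType).

Definition decode (v : space) : {ffun 'I_n -> 'M[R[i]]_n} :=
  [ffun l => \matrix_(i, j) (v (l, (i, j), true) +i* v (l, (i, j), false))%C].

Definition encode (A : {ffun 'I_n -> 'M[R[i]]_n}) : space := fun t =>
  let z := A t.1.1 t.1.2.1 t.1.2.2 in if t.2 then complex.Re z else complex.Im z.

Lemma encodeK A : decode (encode A) = A.
Proof.
apply/ffunP => l; apply/matrixP => i j; rewrite ffunE mxE /encode /=.
by case: (A l i j).
Qed.

Lemma ccont_decode l i j : ccont (fun v => decode v l i j).
Proof.
have E v : decode v l i j = (v (l, (i, j), true) +i* v (l, (i, j), false))%C.
  by rewrite ffunE mxE.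
by split; under [X in continuous X]funext do rewrite E /=; apply: proj_continuous.
Qed.

Lemma closed_MatTup : closed [set v | MatTup M (decode v)]%classic.
Proof.
have -> : [set v | MatTup M (decode v)]%classic =
  ([set v | forall l, psdmx (decode v l) /\ \tr (decode v l) = 1] `&`
   [set v | \sum_l decode v l = M])%classic by [].
apply: closedI; last first.
  have -> : [set v | \sum_l decode v l = M]%classic =
      [set v | forall i j, \sum_l decode v l i j = M i j]%classic.
    apply/seteqP; split=> v /= => [<- i j|h]; first by rewrite summxE.
    by apply/matrixP => i j; rewrite summxE h.
  apply: closed_forall => i; apply: closed_forall => j; apply: closed_ccont_eq.
    by apply: ccont_sum => l; apply: ccont_decode.
  exact: ccont_cst.
apply: closed_forall => l; apply: closedI; last first.
  apply: closed_ccont_eq; last exact: ccont_cst.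
  by apply: ccont_sum => i; apply: ccont_decode.
apply: closedI; last first.
  apply: closed_forall => x; apply: closed_ccont_ge0.
  have -> : (fun v => (x^t* *m decode v l *m x) 0 0) =
      (fun v => \sum_j (\sum_i (x i 0)^* * decode v l i j) * x j 0).
    apply: funext => v; rewrite mxE; apply: eq_bigr => j _; rewrite mxE.
    by congr (_ * _); apply: eq_bigr => i _; rewrite !mxE.
  apply: ccont_sum => j; apply: ccontM; last exact: ccont_cst.
  apply: ccont_sum => i; apply: ccontM; first exact: ccont_cst.
  exact: ccont_decode.
suff : closed [set v | decode v l \is hermsymmx]%classic by [].
have -> : [set v | decode v l \is hermsymmx]%classic =
    [set v | forall i j, (decode v l j i)^* = decode v l i j]%classic.
  apply/seteqP; split=> v /=.
    by move=> /hermsymmxP/matrixP h i j; rewrite -[RHS]h !mxE.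
  by move=> h; apply/hermsymmxP/matrixP => i j; rewrite !mxE h.
apply: closed_forall => i; apply: closed_forall => j; apply: closed_ccont_eq.
  by apply: ccont_conj; apply: ccont_decode.
exact: ccont_decode.
Qed.

Lemma bounded_MatTup v : MatTup M (decode v) -> forall t, v t \in `[-1, 1].
Proof.
move=> [h _] [[l [i j]] b]; have [pA tA] := h l.
have := psdmx_entry_le i j pA; rewrite tA ffunE mxE => le1.
rewrite in_itv /= -ler_norml -(@expr_le1 _ 2) // real_normK ?num_real //.
have : `|(v (l, (i, j), true) +i* v (l, (i, j), false))%C| ^+ 2 <= 1.
  by rewrite expr_le1.
rewrite normc_def /= -rmorphXn sqr_sqrtr ?addr_ge0 ?sqr_ge0 //.
rewrite -(rmorph1 (real_complex R)) lecR; apply: le_trans.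
by case: b; rewrite ?lerDl ?lerDr sqr_ge0.
Qed.

Local Notation mixdetC := (@mixdet (R[i] : numClosedFieldType) n).

Lemma minimizer_exists A0 : MatTup M A0 ->
  (forall A : {ffun 'I_n -> 'M[R[i]]_n}, MatTup M A -> 0 <= mixdetC A) ->
  exists2 A : {ffun 'I_n -> 'M[R[i]]_n}, MatTup M A &
    forall B : {ffun 'I_n -> 'M[R[i]]_n}, MatTup M B -> mixdetC A <= mixdetC B.
Proof.
move=> A0M mix0; pose S : set space := [set v | MatTup M (decode v)]%classic.
have cS : compact S.
  apply: (subclosed_compact closed_MatTup
    (tychonoff (fun _ : coord => @segment_compact R (-1) 1))).
  by move=> v /bounded_MatTup h t; apply: h.
have S0 : (S !=set0)%classic by exists (encode A0); rewrite /S /= encodeK.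
have cf : continuous (fun v : space => complex.Re (mixdetC (decode v)) : R).
  suff : ccont (fun v => mixdetC (decode v)) by case.
  apply: ccont_sum => t; apply: ccont_sum => s; apply: ccontM.
    exact: ccont_cst.
  apply: ccont_prod => i; under [X in ccont X]funext do rewrite mxE.
  exact: ccont_decode.
have [v vS minv] := compact_EVT_min S0 cS (continuous_subspaceT cf).
exists (decode v) => [|B BM]; first by move: vS; rewrite inE.
have := minv (encode B); rewrite inE /S /= encodeK => /(_ BM).
rewrite inE in vS.
by rewrite -lecR !RRe_real // ger0_real // mix0.
Qed.

End Minimizer.
End Compactness.

(** * Univariate polynomials with roots in a half plane *)

Section Univariate.
Variable C : numClosedFieldType.
Implicit Types (p u : {poly C}) (ws : seq C).

Lemma le0_small (a K : C) : 0 <= a -> 0 <= K ->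
  (forall e, 0 < e -> e <= 1 -> a <= e * K) -> a = 0.
Proof.
move=> a0 K0 h; apply/eqP; apply: contraT => an0.
have agt : 0 < a by rewrite lt_def an0.
have D : 0 < a + K + 1 by rewrite -addrA ltr_wpDr // addr_ge0 ?ler01.
have := h (a / (a + K + 1)); rewrite divr_gt0 // ler_pdivrMr // mul1r.
rewrite -addrA lerDl addr_ge0 ?ler01 // => /(_ isT isT).
rewrite mulrAC addrA ler_pdivlMr // ler_pM2l //.
have lt : K < a + K + 1 by rewrite addrAC ltrDr addr_gt0 ?ltr01.
by move/(lt_le_trans lt); rewrite ltxx.
Qed.

Lemma horner_near0 p : exists2 K, 0 <= K &
  forall e, 0 < e -> e <= 1 -> `|p.[0] - p.[e]| <= e * K.
Proof.
elim/poly_ind: p => [|p c [K K0 IH]].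
  by exists 0 => // e _ _; rewrite !horner0 subrr normr0 mulr0.
exists (`|p.[0]| + K) => [|e e0 e1]; first by rewrite addr_ge0.
rewrite !hornerMXaddC mulr0 add0r opprD addrCA subrr addr0 normrN normrM.
rewrite (gtr0_norm e0) mulrC; apply: ler_wpM2l; first exact: ltW.
rewrite -[p.[e]](subKr p.[0]) (le_trans (ler_normB _ _)) // lerD2l.
apply: le_trans (IH _ e0 e1) _.
by rewrite ler_piMl.
Qed.

(** Nonnegativity passes to the limit: [p.[0]] differs from its modulus by at
    most twice its distance to the nonnegative number [p.[e]], hence by a
    multiple of [e]. *)
Lemma horner0_ge0 p : (forall e, 0 < e -> 0 <= p.[e]) -> 0 <= p.[0].
Proof.
move=> h; have [K K0 hK] := horner_near0 p.
suff /eqP : `| p.[0] - `|p.[0]| | = 0.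
  by rewrite normr_eq0 subr_eq0 => /eqP ->.
apply: (@le0_small _ (2 * K)) => // [|e e0 e1]; first by rewrite mulr_ge0.
rewrite mulrCA mulr_natl mulr2n.
rewrite -[X in `|X|](subrKA p.[e]); apply: le_trans (ler_normD _ _) _.
rewrite lerD ?hK // -{1}(ger0_norm (h _ e0)).
apply: le_trans (hK _ e0 e1); rewrite [X in _ <= X]distrC.
by apply: ler_dist_dist.
Qed.

Lemma horner_ge p b : (forall e, 0 < e -> b <= p.[e]) -> b <= p.[0].
Proof.
move=> h; have := @horner0_ge0 (p - b%:P); rewrite !hornerE subr_ge0.
by apply=> e /h; rewrite !hornerE subr_ge0.
Qed.

Lemma deriv0_le p u : p.[0] = u.[0] ->
  (forall e, 0 < e -> p.[e] <= u.[e]) -> p^`().[0] <= u^`().[0].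
Proof.
move=> e0 le_pu; rewrite -subr_ge0.
have /factor_theorem[v ev] : root (u - p) 0 by rewrite rootE !hornerE e0 subrr.
have -> : u^`().[0] - p^`().[0] = v.[0].
  have /(congr1 (fun q => q.[0])) : (u - p)^`() = v^`() * ('X - 0%:P) + v.
    by rewrite ev derivM derivXsubC mulr1.
  by rewrite derivB !hornerE oppr0 mulr0 add0r.
apply: horner0_ge0 => e e_gt0; have := le_pu e e_gt0.
by rewrite -subr_ge0 -hornerN -hornerD ev !hornerE ?subr0 pmulr_lge0.
Qed.

Lemma prod_1DX0 ws : (\prod_(w <- ws) (1 + w *: 'X)).[0] = 1 :> C.
Proof. by rewrite horner_prod big1 // => w _; rewrite !hornerE ?mulr0 ?addr0. Qed.

Lemma deriv_prod_1DX ws :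
  (\prod_(w <- ws) (1 + w *: 'X))^`().[0] = \sum_(w <- ws) w :> C.
Proof.
elim: ws => [|w ws IH]; first by rewrite !big_nil derivC horner0.
rewrite !big_cons derivM derivD derivZ derivX -polyC1 derivC polyC1.
by rewrite !hornerE IH prod_1DX0 ?(mulr1, mulr0, addr0, add0r, mul1r).
Qed.

(** The factorisation over the roots, normalised at [0]: the [w] are the
    negated inverses of the roots, so that the logarithmic derivative at [0]
    is their sum. *)
Lemma poly_root_form p : p.[0] != 0 -> exists ws : seq C,
  [/\ size ws = (size p).-1, forall w, w \in ws -> w != 0 /\ root p (- w^-1)
    & p = p.[0] *: \prod_(w <- ws) (1 + w *: 'X)].
Proof.
move=> p0; have [rs ers] := closed_field_poly_normal p.
have pn0 : p != 0 by apply: contraNneq p0 => ->; rewrite horner0.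
have rn0 r : r \in rs -> r != 0.
  move=> rr; apply: contraNneq p0 => r0; rewrite -[_ == 0]/(root p 0) -r0 ers.
  by rewrite rootZ ?lead_coef_eq0 // root_prod_XsubC.
exists [seq - r^-1 | r <- rs]; split.
- by rewrite size_map {1}ers size_scale ?lead_coef_eq0 // size_prod_XsubC.
- move=> _ /mapP[r rr ->]; rewrite oppr_eq0 invr_eq0 rn0 //; split=> //.
  rewrite invrN opprK invrK ers rootZ ?lead_coef_eq0 //.
  by rewrite root_prod_XsubC.
- rewrite {1}ers {2}ers hornerZ -scalerA; congr (_ *: _).
  rewrite big_map horner_prod -mul_polyC rmorph_prod -big_split /=.
  apply: eq_big_seq => r rr; rewrite !hornerE scaleNr mulrBr mulr1.
  by rewrite -mul_polyC mulrA -polyCM mulNr mulfV ?rn0 // !polyCN polyC1 mulN1r opprK addrC.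
Qed.

Lemma Im_oppV (z : C) : 'Im (- z^-1) = 'Im z / `|z| ^+ 2.
Proof. by rewrite raddfN /= ImV mulNr opprK. Qed.

(** Gauss-Lucas at the origin: the roots lie in the open lower half plane,
    hence so do their negated inverses, whose sum is the logarithmic derivative
    at [0]. *)
Lemma deriv0_upper_neq0 p : (1 < size p)%N ->
  (forall t, 0 <= 'Im t -> p.[t] != 0) -> p^`().[0] != 0.
Proof.
move=> sp hp; have p0 : p.[0] != 0 by apply: hp; rewrite raddf0.
have [ws [sws wP ep]] := poly_root_form p0.
rewrite ep derivZ hornerZ deriv_prod_1DX mulf_neq0 //.
have wIm w : w \in ws -> 'Im w < 0.
  move=> /wP[wn0 rw]; have tn0 : - w^-1 != 0 by rewrite oppr_eq0 invr_eq0.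
  have -> : w = - (- w^-1)^-1 by rewrite invrN opprK invrK.
  rewrite Im_oppV pmulr_llt0 ?invr_gt0 ?exprn_gt0 ?normr_gt0 //.
  rewrite real_ltNge ?real0 ?Creal_Im //.
  by apply: contraTN rw => /hp; rewrite rootE.
apply/eqP => /(congr1 (@Im C)); rewrite raddf_sum raddf0 /=.
case: ws sws wIm {wP ep} => [|w ws] /=; first by case: (size p) sp => [|[]].
move=> _ wIm; rewrite big_cons; apply/eqP; rewrite lt_eqF //.
apply: le_lt_trans (wIm w _); last by rewrite mem_head.
rewrite gerDl big_seq_cond sumr_le0 // => v /andP[vw _].
by apply/ltW/wIm; rewrite inE vw orbT.
Qed.

End Univariate.

(** For [0 < d], the inverse of the infimum of [(1 + t / d) ^ d / t] over [t > 0]. *)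
Definition gurvits (F : numFieldType) (d : nat) : F :=
  (d.-1%:R / d%:R) ^+ d.-1.

Lemma gurvits_ge0 (F : numFieldType) d : 0 <= gurvits F d.
Proof. by rewrite exprn_ge0 // divr_ge0. Qed.

Lemma gurvits_le1 (F : numFieldType) d : gurvits F d <= 1.
Proof.
case: d => [|d]; first by rewrite /gurvits expr0.
rewrite exprn_ile1 ?divr_ge0 // ler_pdivrMr ?ltr0Sn // mul1r ler_nat.
exact: leqnSn.
Qed.

Section CapacityStep.
Variable C : numClosedFieldType.
Implicit Types (u : {poly C}) (ws : seq C).

Lemma prod_1D_le ws d t : (0 < d)%N -> (size ws <= d)%N -> 0 <= t ->
  (forall w, w \in ws -> 0 <= w) ->
  \prod_(w <- ws) (1 + w * t) <= (1 + (\sum_(w <- ws) w) * t / d%:R) ^+ d.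
Proof.
move=> d0 sws t0 ws0; pose ws' := ws ++ nseq (d - size ws) 0.
have sws' : size ws' = d by rewrite size_cat size_nseq subnKC.
have ws0' w : w \in ws' -> 0 <= w.
  by rewrite mem_cat => /orP[/ws0//|/nseqP[->]].
have -> : \prod_(w <- ws) (1 + w * t) = \prod_(w <- ws') (1 + w * t).
  rewrite big_cat /= [X in _ * X]big1_seq ?mulr1 // => w /andP[_ /nseqP[-> _]].
  by rewrite mul0r addr0.
have -> : \sum_(w <- ws) w = \sum_(w <- ws') w.
  by rewrite big_cat /= [X in _ + X]big1_seq ?addr0 // => w /andP[_ /nseqP[-> _]].
rewrite [\prod_(w <- ws') _](big_nth 0) [\sum_(w <- ws') _](big_nth 0).
rewrite !big_mkord !sws'.
have := @leif_AGM C 'I_d predT (fun k => 1 + ws'`_k * t).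
rewrite /= cardT size_enum_ord => /(_ _)[] => [k _|].
  by rewrite addr_ge0 ?ler01 // mulr_ge0 // ws0' // mem_nth // sws'.
move=> le_AGM _; apply: le_trans le_AGM _; rewrite big_split /= sumr_const.
by rewrite cardT size_enum_ord -mulr_suml mulrDl divff // pnatr_eq0 -lt0n.
Qed.

Lemma le_of_affine (k a b : C) : 0 <= k -> 0 < a -> 0 <= b ->
  (forall t, 0 < t -> k * t <= a + b * t) -> k <= b.
Proof.
move=> k0 a0 b0 h; rewrite real_leNgt ?ger0_real //; apply/negP => lt_bk.
have kb : 0 < k - b by rewrite subr_gt0.
have := h (2 * a / (k - b)); rewrite divr_gt0 ?mulr_gt0 // => /(_ isT).
rewrite -lerBlDr -mulrBl mulrC divfK ?gt_eqF // mulr_natl mulr2n gerDl.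
by move=> /(lt_le_trans a0); rewrite ltxx.
Qed.

(** AM-GM over the roots bounds [u] by a [d]-th power of an affine function,
    for which the infimum of [u.[t] / t] is explicit; the critical point is
    [t = d / ((d - 1) S)], at infinity when [d = 1]. *)
Lemma gurvits_step u d k : (0 < d)%N -> (size u <= d.+1)%N -> 0 < u.[0] ->
  (forall r, root u r -> r < 0) -> 0 <= k ->
  (forall t, 0 < t -> k * t <= u.[t]) -> k * gurvits C d <= u^`().[0].
Proof.
move=> d0 su a0 ru k0 hk; have [ws [sws wP eu]] := poly_root_form (lt0r_neq0 a0).
have w0 w : w \in ws -> 0 < w.
  by move=> /wP[_ /ru]; rewrite oppr_lt0 invr_gt0.
rewrite eu derivZ hornerZ deriv_prod_1DX.
set a := u.[0] in a0 eu *; set S := \sum_(w <- ws) w.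
have S0 : 0 <= S by rewrite /S big_seq_cond sumr_ge0 // => w /andP[/w0/ltW].
have ub t : 0 < t -> k * t <= a * (1 + S * t / d%:R) ^+ d.
  move=> t0; apply: le_trans (hk t t0) _; rewrite eu hornerZ ler_pM2l // horner_prod.
  rewrite (eq_bigr (fun w => 1 + w * t)); last by move=> w _; rewrite !hornerE.
  apply: prod_1D_le => //; [by rewrite sws; case: (size u) su|exact: ltW|].
  by move=> w /w0/ltW.
have [dS|] := boolP ((d == 1%N) || (S == 0)).
  apply: le_trans (_ : k * 1 <= _).
    by apply: ler_wpM2l; rewrite ?gurvits_le1.
  rewrite mulr1; apply: (@le_of_affine _ a) => // [|t t0].
    by rewrite mulr_ge0 // ltW.
  apply: le_trans (ub t t0) _; case/orP: dS => /eqP ->.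
    by rewrite expr1 divr1 mulrDr mulr1 mulrA.
  by rewrite !mul0r mulr0 mul0r !addr0 expr1n mulr1.
rewrite negb_or => /andP[d1 Sn0].
have Sgt0 : 0 < S by rewrite lt_def Sn0.
case: d d0 d1 su ub => [|[|m]] // _ _ _ ub; rewrite /gurvits /=.
pose x : C := m.+2%:R / m.+1%:R.
have x0 : 0 < x by rewrite divr_gt0 ?ltr0Sn.
have -> : m.+1%:R / m.+2%:R = x^-1 :> C by rewrite invf_div.
have := ub (x / S); rewrite divr_gt0 // => /(_ isT).
have -> : 1 + S * (x / S) / m.+2%:R = x.
  rewrite mulrCA divff // mulr1 /x mulrAC divff ?pnatr_eq0 //.
  by rewrite -[X in X + _](@divff _ m.+1%:R) ?pnatr_eq0 // -mulrDl natr1.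
rewrite exprS [a * _]mulrCA [k * _]mulrCA ler_pM2l // ler_pdivrMr // => le_k.
by rewrite exprVn ler_pdivrMr ?exprn_gt0 // mulrAC.
Qed.

End CapacityStep.

(** * Strictly stable polynomials and their capacity *)

Import mpoly.

Section Line.
Variables (C : comRingType) (n : nat).
Implicit Types (q : {mpoly C[n]}) (i j : 'I_n) (z : 'I_n -> C) (t : C).

Definition update z i t j := if j == i then t else z j.

(** The polynomial variable is the [i]-th coordinate itself and not a
    displacement from [z]: the [i]-th entry of [z] is ignored. *)
Definition line q i z : {poly C} :=
  mmap (@polyC C) (fun j => if j == i then 'X else (z j)%:P) q.

Lemma mmap1_line i z (m : 'X_{1..n}) :
  mmap1 (fun j => if j == i then 'X else (z j)%:P) m =
  (\prod_(j | j != i) z j ^+ m j) *: 'X^(m i) :> {poly C}.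
Proof.
rewrite /mmap1 (bigD1 i) //= eqxx mulrC -mul_polyC rmorph_prod; congr (_ * _).
by apply: eq_bigr => j /negPf jni; rewrite jni rmorphXn.
Qed.

Lemma lineE q i z : line q i z =
  \sum_(m <- msupp q) (q@_m * \prod_(j | j != i) z j ^+ m j) *: 'X^(m i).
Proof.
by apply: eq_bigr => m _; rewrite mmap1_line mul_polyC scalerA.
Qed.

Lemma horner_line q i z t : (line q i z).[t] = q.@[update z i t].
Proof.
rewrite lineE mevalE horner_sum; apply: eq_bigr => m _.
rewrite hornerZ hornerXn -mulrA; congr (_ * _).
rewrite [RHS](bigD1 i) //= /update eqxx mulrC; congr (_ * _).
by apply: eq_bigr => j /negPf ->.
Qed.

Lemma deriv_line q i z : (line q i z)^`() = line q^`M(i) i z.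
Proof.
rewrite /line; elim/mpolyind: q => [|c m p _ _ IH].
  by rewrite mderiv0 !mmap0 derivC.
rewrite mderivD mderivZ mderivX scalerA !mmapD derivD {}IH; congr (_ + _).
rewrite !mmapZ !mmapX !mul_polyC derivZ -scalerA !mmap1_line derivZ derivXn.
congr (_ *: _); rewrite mnmBE mnm1E eqxx subn1 -scaler_nat !scalerA mulrC.
congr (_ * _ *: _); apply: eq_bigr => j jni.
by rewrite mnmBE mnm1E eq_sym (negPf jni) subn0.
Qed.

Lemma dhomog_sum q d (m : 'X_{1..n}) : q \is d.-homog -> m \in msupp q ->
  (\sum_j m j)%N = d.
Proof. by move=> /dhomogP h /h <-; rewrite -mdegE. Qed.

Lemma size_line q i z d : q \is d.-homog -> (size (line q i z) <= d.+1)%N.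
Proof.
move=> hq; rewrite lineE; apply: leq_trans (size_sum _ _ _) _.
apply/bigmax_leqP_seq => m /(dhomog_sum hq) <- _.
apply: leq_trans (size_scale_leq _ _) _; rewrite size_polyXn ltnS.
by rewrite (bigD1 i) //= leq_addr.
Qed.

(** In a form of degree [d] only the monomial [x_i ^ d] reaches degree [d] along
    the [i]-th axis, so the top coefficient does not depend on the line. *)
Lemma coef_line q i z d : q \is d.-homog ->
  (line q i z)`_d = q.@[update (fun _ => 0) i 1].
Proof.
move=> hq; rewrite -horner_line !lineE coef_sum horner_sum.
apply: eq_big_seq => m /(dhomog_sum hq) <-; rewrite coefZ coefXn hornerZ hornerXn expr1n.
have [e|ne] := eqVneq ((\sum_j m j)%N) (m i).
  congr (_ * _ * _); apply: eq_bigr => j ji; suff -> : m j = 0%N by rewrite !expr0.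
  move/eqP: e; rewrite (bigD1 i) //= -[X in _ == X]addn0 eqn_add2l.
  by rewrite (bigD1 j) //= addn_eq0 => /andP[/eqP].
rewrite mulr0 mulr1; symmetry.
have [j ji mj] : exists2 j, j != i & m j != 0%N.
  apply/exists_inP; apply: contraNT ne; rewrite negb_exists_in.
  move=> /forall_inP h; rewrite (bigD1 i) //= big1 ?addn0 // => j /h.
  by rewrite negbK => /eqP.
by rewrite (bigD1 j) //= expr0n (negPf mj) mul0r mulr0.
Qed.

Lemma meval_scale q d t z : q \is d.-homog ->
  q.@[fun j => t * z j] = t ^+ d * q.@[z].
Proof.
move=> hq; rewrite !mevalE mulr_sumr; apply: eq_big_seq => m /(dhomog_sum hq) <-.
rewrite mulrCA; congr (_ * _); rewrite -prodrXr -big_split /=.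
by apply: eq_bigr => j _; rewrite exprMn.
Qed.

Lemma dhomog_mderiv q d i : q \is d.+1.-homog -> q^`M(i) \is d.-homog.
Proof.
move=> hq; apply/dhomogP => m; rewrite mcoeff_msupp mcoeff_deriv => mq.
have : (m + U_(i))%MM \in msupp q.
  by rewrite mcoeff_msupp; apply: contraNneq mq => ->; rewrite mul0rn.
by move=> /(dhomog_sum hq); rewrite -mdegE mdegD mdeg1 addn1 => -[].
Qed.

End Line.

Section Stability.
Variables (C : numClosedFieldType) (n : nat).
Implicit Types (q : {mpoly C[n]}) (i j : 'I_n) (z x : 'I_n -> C) (t : C).
Implicit Types (s : seq 'I_n).

(** Stability in the strict form satisfied by determinants of positive
    definite pencils: [q] may not vanish as soon as one coordinate has
    positive imaginary part and none has a negative one.  Unlike stability on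
    the open half plane, it passes to [i]-th derivatives restricted to
    [x_i = 0] without any limit; [s] lists the coordinates already removed. *)
Definition strictly_stable s q := forall z,
  (forall j, j \in s -> z j = 0) -> (forall j, 0 <= 'Im (z j)) ->
  (exists j, 0 < 'Im (z j)) -> q.@[z] != 0.

Definition positive_off s q := forall x,
  (forall j, j \in s -> x j = 0) -> (forall j, 0 <= x j) ->
  (exists j, 0 < x j) -> 0 < q.@[x].

(** The largest such [k] is the capacity of [q] as a polynomial in the
    coordinates outside [s]. *)
Definition capacity_ge s q (k : C) := forall x,
  (forall j, j \in s -> x j = 0) -> (forall j, j \notin s -> 0 < x j) ->
  k * \prod_(j | j \notin s) x j <= q.@[x].

Section Step.
Variables (q : {mpoly C[n]}) (d : nat) (s : seq 'I_n) (i : 'I_n).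
Hypotheses (hq : q \is d.+1.-homog) (stq : strictly_stable s q)
  (posq : positive_off s q) (is_ : i \notin s).

Lemma update_off z t : (forall j, j \in i :: s -> z j = 0) ->
  forall j, j \in s -> update z i t j = 0.
Proof.
move=> z0 j js; rewrite /update ifN ?z0 ?inE ?js ?orbT //.
by apply: contraNneq is_ => <-.
Qed.

Lemma update_id z : (forall j, j \in i :: s -> z j = 0) -> update z i 0 =1 z.
Proof. by move=> z0 j; rewrite /update; case: eqP => // ->; rewrite z0 ?mem_head. Qed.

Lemma lead_line_neq0 : q.@[update (fun _ => 0) i 1] != 0.
Proof.
apply: lt0r_neq0; apply: posq => [j js|j|].
- by apply: update_off.
- by rewrite /update; case: ifP; rewrite ?ler01.
- by exists i; rewrite /update eqxx ltr01.
Qed.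

Lemma line_size_gt1 z : (1 < size (line q i z))%N.
Proof.
apply: (@leq_trans d.+2) => //; rewrite ltnNge; apply/negP => /leq_sizeP.
by move=> /(_ d.+1 (leqnn _)) /eqP; rewrite (coef_line _ _ hq) (negPf lead_line_neq0).
Qed.

Lemma deriv_line0 z : (forall j, j \in i :: s -> z j = 0) ->
  (line q i z)^`().[0] = (q^`M(i)).@[z].
Proof. by move=> z0; rewrite deriv_line horner_line; apply/meval_eq/update_id. Qed.

(** The roots of [t |-> q (z + t e_i)] have negative imaginary parts, and there
    is at least one of them since the top coefficient is [q e_i <> 0]; so
    [deriv0_upper_neq0] applies. *)
Lemma strictly_stable_mderiv : strictly_stable (i :: s) q^`M(i).
Proof.
move=> z z0 zI [k zk]; rewrite -deriv_line0 //.
apply: deriv0_upper_neq0; first exact: line_size_gt1.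
move=> t t0; rewrite horner_line; apply: stq => [j js|j|].
- exact: update_off.
- by rewrite /update; case: ifP.
- exists k; rewrite /update; case: eqP => // ki; move: zk.
  by rewrite ki z0 ?mem_head // raddf0 ltxx.
Qed.

(** Nonreal roots are excluded by stability, applied to [r] or, by
    homogeneity, to [- r]; nonnegative ones by positivity. *)
Lemma line_roots_neg x r : (forall j, j \in i :: s -> x j = 0) ->
  (forall j, 0 <= x j) -> (exists j, 0 < x j) -> root (line q i x) r -> r < 0.
Proof.
move=> xs x0 [k xk]; rewrite rootE horner_line => qr.
have xI j : 'Im (x j) = 0 by apply/Creal_ImP/ger0_real.
have rr : r \is Num.real.
  apply/Creal_ImP/eqP; apply: contraLR qr => rI.
  have /orP[rI0|rI0] : (0 < 'Im r) || ('Im r < 0).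
  - by rewrite orbC -real_neqr_lt ?real0 ?Creal_Im.
  - apply: stq => [j js|j|]; [exact: update_off| |].
      by rewrite /update; case: ifP; rewrite ?xI // ltW.
    by exists i; rewrite /update eqxx.
  - have := meval_scale (-1) (update x i r) hq; rewrite mulrC => e.
    suff : q.@[fun j => -1 * update x i r j] != 0.
      by rewrite e; apply: contraNneq => ->; rewrite mul0r.
    apply: stq => [j js|j|]; first by rewrite update_off ?mulr0.
      rewrite mulN1r raddfN /= /update; case: ifP; rewrite ?xI ?oppr0 //.
      by rewrite oppr_ge0 ltW.
    by exists i; rewrite mulN1r raddfN /= /update eqxx oppr_gt0.
rewrite real_ltNge ?real0 //; apply: contraL qr => r0; apply: lt0r_neq0.
apply: posq => [j js|j|]; [exact: update_off|by rewrite /update; case: ifP|].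
exists k; rewrite /update; case: eqP => // ki; move: xk.
by rewrite ki xs ?mem_head // ltxx.
Qed.

Lemma line0_gt0 x : (forall j, j \in i :: s -> x j = 0) ->
  (forall j, 0 <= x j) -> (exists j, 0 < x j) -> 0 < (line q i x).[0].
Proof.
move=> xs x0 xk; rewrite horner_line (meval_eq _ (update_id xs)).
by apply: posq => // j js; apply: xs; rewrite inE js orbT.
Qed.

(** The logarithmic derivative at [0] is the sum of the positive numbers
    [- 1 / r] over the roots [r]. *)
Lemma positive_off_mderiv : positive_off (i :: s) q^`M(i).
Proof.
move=> x xs x0 xk; rewrite -deriv_line0 //.
have l0 := line0_gt0 xs x0 xk.
have [ws [sws wP ep]] := poly_root_form (lt0r_neq0 l0).
rewrite ep derivZ hornerZ deriv_prod_1DX mulr_gt0 //.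
have w0 w : w \in ws -> 0 < w.
  move=> /wP[_ /(line_roots_neg xs x0 xk)]; by rewrite oppr_lt0 invr_gt0.
case: ws sws w0 {wP ep} => [|w ws] /=.
  by have := line_size_gt1 x; case: (size _) => [|[]].
move=> _ w0; rewrite big_cons ltr_pwDl ?w0 ?mem_head // big_seq_cond sumr_ge0 //.
by move=> v /andP[vw _]; apply/ltW/w0; rewrite inE vw orbT.
Qed.

Lemma capacity_ge_mderiv k : 0 <= k -> (exists j, j \notin i :: s) ->
  capacity_ge s q k ->
  capacity_ge (i :: s) q^`M(i) (k * gurvits C d.+1).
Proof.
move=> k0 [j0 j0s] cq x xs xp; rewrite -deriv_line0 //.
have x0 j : 0 <= x j.
  by have [/xs->|/xp/ltW] := boolP (j \in i :: s).
have ck t : 0 < t -> (k * \prod_(j | j \notin i :: s) x j) * t <= (line q i x).[t].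
  move=> t0; rewrite horner_line.
  have u0 : forall j, j \in s -> update x i t j = 0 by apply: update_off.
  have up j : j \notin s -> 0 < update x i t j.
    by rewrite /update; case: eqP => // /eqP ji js; apply: xp; rewrite inE negb_or ji.
  apply: le_trans (cq _ u0 up); rewrite [X in _ <= _ * X](bigD1 i) //= {1}/update eqxx.
  rewrite -mulrA [_ * t]mulrC; rewrite le_eqVlt; apply/orP; left; apply/eqP; congr (_ * (_ * _)).
  under eq_bigl => j do rewrite inE negb_or andbC.
  by apply: eq_bigr => j /andP[_ /negPf ji]; rewrite /update ji.
rewrite mulrAC; apply: gurvits_step => //; first exact: size_line.
- by apply: line0_gt0 => //; exists j0; apply: xp.
- by move=> r; apply: line_roots_neg => //; exists j0; apply: xp.
- by rewrite mulr_ge0 // prodr_ge0.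
Qed.

End Step.

(** For the last variable the line starts at the origin, where [q] vanishes,
    and [gurvits_step] does not apply; but then [q] is linear on that line. *)
Lemma capacity_ge_last q s i k : q \is 1.-homog -> i \notin s ->
  (forall j, j \in i :: s) -> capacity_ge s q k ->
  capacity_ge (i :: s) q^`M(i) k.
Proof.
move=> hq is_ all_s cq x xs xp; rewrite (eq_bigl pred0) => [|j]; last by rewrite all_s.
rewrite big_pred0_eq mulr1 -(deriv_line0 _ xs).
have u0 : (line q i x).[0] = 0.
  rewrite horner_line (meval_eq _ (update_id xs)).
  rewrite -(meval_eq _ (_ : (fun j => 0 * x j) =1 x)) ?(meval_scale _ _ hq) ?mul0r //.
  by move=> j; rewrite mul0r xs.
have := cq (update x i 1); rewrite (big_pred1 i) => [|j]; last first.
  by have := all_s j; rewrite inE /=; case: eqP => [-> _|_ /= ->] //; rewrite is_.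
rewrite /update eqxx mulr1 -/(update x i 1) -horner_line => le_k.
apply: le_trans (le_k _ _) _ => [j js|j js|].
- by rewrite ifN ?xs //; apply: contraNneq is_ => <-.
- have := all_s j; rewrite inE (negPf js) orbF => /eqP ->; rewrite eqxx.
  exact: ltr01.
rewrite horner_coef0 coef_deriv mulr1n (horner_coef_wide _ (size_line _ _ hq)).
by rewrite big_ord_recl big_ord1 /= expr0 !expr1n !mulr1 -horner_coef0 u0 add0r.
Qed.

(** Gurvits' capacity inequality: removing the variables of [t] one after
    the other costs [gurvits d] when [d] of them are left. *)
Lemma capacity_bound (t s : seq 'I_n) q k : uniq (t ++ s) -> (forall j, j \in t ++ s) ->
  q \is (size t).-homog -> strictly_stable s q -> positive_off s q -> 0 <= k ->
  capacity_ge s q k ->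
  k * \prod_(1 <= d < (size t).+1) gurvits C d <=
    (foldr (fun i q => q^`M(i)) q t).@[fun _ => 0].
Proof.
elim/last_ind: t s q k => [|t i IH] s q k.
  move=> _ all_s _ _ _ _ cq; rewrite big_geq // mulr1 /=.
  have := cq (fun _ => 0); rewrite big_pred0 => [|j]; last by rewrite (all_s j).
  rewrite mulr1; apply=> // j; by rewrite (all_s j).
rewrite size_rcons cat_rcons => us all_s hq stq posq k0 cq.
have is_ : i \notin s.
  by move: us; rewrite cat_uniq => /and3P[_ _ /andP[]].
rewrite foldr_rcons big_nat_recr //= mulrA mulrAC.
apply: (IH (i :: s)) => //.
- exact: dhomog_mderiv.
- exact: strictly_stable_mderiv hq stq posq is_.
- exact: positive_off_mderiv hq stq posq is_.
- by rewrite mulr_ge0 ?gurvits_ge0.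
case: t hq us all_s {IH} => [|j t] hq us all_s.
  by rewrite /gurvits expr0 mulr1; apply: capacity_ge_last.
apply: capacity_ge_mderiv hq stq posq is_ _ k0 _ cq.
exists j; move: us => /= /andP[]; by rewrite mem_cat negb_or => /andP[_ ->].
Qed.

End Stability.

(** * The determinantal polynomial of a tuple *)

Section DeterminantalPolynomial.
Variables (F : comNzRingType) (n : nat).
Implicit Types (A : 'I_n -> 'M[F]_n).

Definition detpoly A : {mpoly F[n]} :=
  \det (\sum_(i < n) 'X_i *: map_mx (@mpolyC n F) (A i)).

Lemma meval_detpoly A z : (detpoly A).@[z] = \det (\sum_i z i *: A i).
Proof.
rewrite /detpoly -det_map_mx; congr (\det _); apply/matrixP => i j.
rewrite !mxE !summxE raddf_sum /=; apply: eq_bigr => k _.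
by rewrite !mxE mevalM mevalXU mevalC.
Qed.

Lemma detpolyE A : detpoly A = \sum_(s : {perm 'I_n}) (-1) ^+ s *
  \prod_i \sum_k (A k i (s i) *: 'X_k).
Proof.
rewrite /detpoly /determinant; apply: eq_bigr => s _; congr (_ * _).
apply: eq_bigr => i _; rewrite summxE; apply: eq_bigr => k _.
by rewrite !mxE mulrC mul_mpolyC.
Qed.

Lemma dhomog_detpoly A : detpoly A \is n.-homog.
Proof.
rewrite detpolyE; apply: rpred_sum => s _; rewrite rpredMsign.
have hr (r : seq 'I_n) : \prod_(i <- r) \sum_k (A k i (s i) *: 'X_k)
    \is (size r).-homog.
  elim: r => [|i r IH]; first by rewrite big_nil dhomog1.
  rewrite big_cons /= -add1n; apply: dhomogM => //; apply: rpred_sum => k _.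
  by apply: rpredZ; rewrite dhomogX /= mdeg1.
by have := hr (enum 'I_n); rewrite size_enum_ord big_enum.
Qed.

Lemma mcoeff_foldr_mderiv (s : seq 'I_n) (q : {mpoly F[n]}) (m : 'X_{1..n}) :
  uniq s -> (forall i, i \in s -> m i = 0%N) ->
  (foldr (fun i q => q^`M(i)) q s)@_m = q@_(m + \sum_(i <- s) U_(i)).
Proof.
elim: s m => [|i s IH] m /=; first by rewrite big_nil addm0.
move=> /andP[is_ us] m0; rewrite mcoeff_deriv m0 ?mem_head // mulr1n IH //.
  by rewrite big_cons addmA.
move=> j js; rewrite mnmDE mnm1E m0 ?inE ?js ?orbT //.
by case: eqP is_ js => // -> /negPf ->.
Qed.

Lemma meval0E (q : {mpoly F[n]}) : q.@[fun _ => 0] = q@_0.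
Proof.
elim/mpolyind: q => [|c m q _ _ IH]; first by rewrite meval0 mcoeff0.
rewrite mevalD mevalZ mevalX mcoeffD mcoeffZ mcoeffX IH; congr (_ * _ + _).
have [->|m0] := eqVneq m 0%MM; first by rewrite big1 // => i _; rewrite mnm0E.
have [i mi] : exists i, m i != 0%N.
  apply/existsP; apply: contraNT m0; rewrite negb_exists => /forallP h.
  by apply/eqP/mnmP => i; rewrite mnm0E; apply/eqP; rewrite -[_ == _]negbK.
by rewrite (bigD1 i) //= expr0n (negPf mi) mul0r.
Qed.

Lemma sum_mnmU_perm (f : {ffun 'I_n -> 'I_n}) :
  ((\sum_i U_(f i))%MM == (\sum_i U_(i))%MM :> 'X_{1..n}) = injectiveb f.
Proof.
have E (g : 'I_n -> 'I_n) k : (\sum_i U_(g i))%MM k = #|[set i | g i == k]|.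
  rewrite mnm_sumE -sum1dep_card [RHS]big_mkcond /=; apply: eq_bigr => i _.
  by rewrite mnm1E; case: eqP.
apply/eqP/injectiveP => [e i j fij|inj].
  have := congr1 (fun m : 'X_{1..n} => m (f i)) e; rewrite /= !E.
  have -> : [set k | k == f i] = [set f i] by apply/setP => k; rewrite !inE.
  rewrite cards1 => /eqP/cards1P[k ek].
  have : i \in [set k] by rewrite -ek inE.
  have : j \in [set k] by rewrite -ek inE fij.
  by rewrite !inE => /eqP-> /eqP->.
rewrite [RHS](reindex_inj inj); by [].
Qed.

(** Expanding the determinant, only the monomials [x_(f 0) ... x_(f (n-1))]
    with [f] bijective survive the [n] derivatives. *)
Lemma mixdetE A :
  (foldr (fun i q => q^`M(i)) (detpoly A) (enum 'I_n)).@[fun _ => 0] = mixdet A.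
Proof.
rewrite meval0E mcoeff_foldr_mderiv ?enum_uniq // => [|i]; last by rewrite mnm0E.
rewrite add0m big_enum /= detpolyE raddf_sum /=.
rewrite /mixdet; under [RHS]eq_bigr do rewrite /determinant.
rewrite [RHS]exchange_big /=; apply: eq_bigr => s _.
rewrite -mulr_sumr mulr_sign fun_if mcoeffN -mulr_sign; congr (_ * _).
rewrite (bigA_distr_bigA (fun i k => A k i (s i) *: 'X_k)) /= raddf_sum /=.
have E (f : {ffun 'I_n -> 'I_n}) :
    (\prod_i (A (f i) i (s i) *: 'X_(f i)))@_(\sum_i U_(i)) =
    (\prod_i A (f i) i (s i)) * (injectiveb f)%:R.
  rewrite (_ : \prod_i _ = (\prod_i A (f i) i (s i)) *: 'X_[\sum_i U_(f i)]).
    by rewrite mcoeffZ mcoeffX sum_mnmU_perm.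
  rewrite -mul_mpolyC -mprodXE rmorph_prod -big_split; apply: eq_bigr => i _ /=.
  by rewrite mul_mpolyC.
under eq_bigr do rewrite E.
rewrite (bigID (fun f : {ffun _} => injectiveb f)) /= [X in _ + X]big1 =>
  [|f /negPf->]; last by rewrite mulr0.
rewrite addr0 (reindex (@pval _)) /=; last first.
  pose in_Sn := insubd (1%g : {perm 'I_n}).
  by exists in_Sn => /= f Uf; first apply: val_inj; apply: insubdK.
apply: eq_big => [t|t _]; first by rewrite (valP t).
rewrite (valP t) mulr1; apply: eq_bigr => i _; by rewrite mxE pvalE.
Qed.

End DeterminantalPolynomial.

Lemma MDE (C : numClosedFieldType) n (A : {ffun 'I_n -> 'M[C]_n}) :
  MD A = (n`!%:R)^-1 * mixdet A.
Proof. by rewrite /MD -mixdetE. Qed.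

Section Pencils.
Local Open Scope sesquilinear_scope.
Variables (C : numClosedFieldType) (n : nat).
Implicit Types (A B : 'I_n -> 'M[C]_n) (x z : 'I_n -> C).

Lemma le_det_psdmx (X Y : 'M[C]_n) : psdmx X -> psdmx Y -> \det X <= \det (X + Y).
Proof.
move=> pX pY; have [->|] := eqVneq (\det X) 0; last by move=> ?; apply: le_det_psdmxD.
exact/psdmx_det_ge0/psdmxD.
Qed.

Lemma psdmx_comb A x (P : pred 'I_n) : (forall j, psdmx (A j)) ->
  (forall j, 0 <= x j) -> psdmx (\sum_(j | P j) x j *: A j).
Proof. by move=> pA x0; apply: psdmx_sum => j _; apply: psdmxZ. Qed.

Lemma posdef_comb A x (P : pred 'I_n) k : (forall j, psdmx (A j)) ->
  (forall j, 0 <= x j) -> P k -> 0 < x k -> \det (A k) != 0 ->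
  \det (\sum_(j | P j) x j *: A j) != 0.
Proof.
move=> pA x0 Pk xk dk; rewrite (bigD1 k) //=; apply: posdefD.
- exact: psdmxZ.
- by rewrite detZ mulf_neq0 // expf_neq0 // lt0r_neq0.
- by apply: psdmx_comb.
Qed.

Section PositiveDefinite.
Variable A : 'I_n -> 'M[C]_n.
Hypotheses (pA : forall j, psdmx (A j)) (dA : forall j, \det (A j) != 0).

Lemma strictly_stable_detpoly : strictly_stable [::] (detpoly A).
Proof.
move=> z _ z0 [k zk]; rewrite meval_detpoly.
have -> : \sum_i z i *: A i =
    \sum_i 'Re (z i) *: A i + 'i *: \sum_i 'Im (z i) *: A i.
  rewrite scaler_sumr -big_split /=; apply: eq_bigr => i _.
  by rewrite scalerA -scalerDl -Crect.
apply: det_upper_neq0; first exact: psdmx_comb.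
  exact: (posdef_comb (k := k)).
elim/big_ind: _ => [|X Y|i _]; [exact: (psdmx0 _ _).1|exact: hermsymmxD|].
by apply: hermsymmxZ; [exact: Creal_Re|exact: (pA i).1].
Qed.

Lemma positive_off_detpoly : positive_off [::] (detpoly A).
Proof.
move=> x _ x0 [k xk]; rewrite meval_detpoly; apply: posdef_det_gt0.
  exact: psdmx_comb.
exact: (posdef_comb (k := k)).
Qed.

End PositiveDefinite.

(** Perturbation turning semidefinite tuples into definite ones. *)
Definition shift A (e : C) i := A i + e *: 1%:M.

Lemma shift_psdmx A e i : psdmx (A i) -> 0 < e -> psdmx (shift A e i).
Proof. by move=> pA e0; apply: psdmxD => //; apply: psdmxZ (psdmx1 _ _); exact: ltW. Qed.

Lemma shift_det A e i : psdmx (A i) -> 0 < e -> \det (shift A e i) != 0.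
Proof.
move=> pA e0; rewrite /shift addrC; apply: posdefD => //.
  by apply: psdmxZ (psdmx1 _ _); exact: ltW.
by rewrite detZ det1 mulr1 expf_neq0 // lt0r_neq0.
Qed.

Lemma mixdet_ge0 A : (0 < n)%N -> (forall j, psdmx (A j)) -> 0 <= mixdet A.
Proof.
move=> n0 pA; have [p pE] := mixdet_poly A (fun _ => 1%:M).
have -> : mixdet A = p.[0].
  by rewrite pE; apply: eq_mixdet => i; rewrite scale0r addr0.
apply: horner0_ge0 => e e0; rewrite pE -/(mixdet (shift A e)) -mixdetE.
have pB j : psdmx (shift A e j) by apply: shift_psdmx.
have dB j : \det (shift A e j) != 0 by apply: shift_det.
rewrite -[X in X <= _](mul0r (\prod_(1 <= d < (size (enum 'I_n)).+1) gurvits C d)).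
apply: (@capacity_bound _ _ _ [::]) => //.
- by rewrite cats0 enum_uniq.
- by move=> j; rewrite cats0 mem_enum.
- by rewrite size_enum_ord; exact: dhomog_detpoly.
- exact: strictly_stable_detpoly.
- exact: positive_off_detpoly.
- move=> x _ x0; rewrite mul0r; apply/ltW/positive_off_detpoly => // [j|].
    exact/ltW/x0.
  by exists (Ordinal n0); apply: x0.
Qed.

(** A singular coefficient makes the determinant drop one degree in its
    variable, and Gurvits' bound for that variable improves accordingly. *)
Lemma mixdet_singular_ge A i0 k : (1 < n)%N -> (forall j, psdmx (A j)) ->
  \det (A i0) = 0 -> 0 <= k ->
  (forall x, (forall j, 0 < x j) -> k * \prod_j x j <= \det (\sum_j x j *: A j)) ->
  k * gurvits C n.-1 * \prod_(1 <= d < n) gurvits C d <= mixdet A.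
Proof.
move=> n1 pA dA0 k0 capA; have [p pE] := mixdet_poly A (fun _ => 1%:M).
have -> : mixdet A = p.[0].
  by rewrite pE; apply: eq_mixdet => i; rewrite scale0r addr0.
apply: horner_ge => e e0; rewrite pE -/(mixdet (shift A e)) -mixdetE.
have pB j : psdmx (shift A e j) by apply: shift_psdmx.
have dB j : \det (shift A e j) != 0 by apply: shift_det.
set B := shift A e in pB dB *; set q := detpoly B.
have stq := strictly_stable_detpoly pB dB.
have posq := positive_off_detpoly pB dB.
have hq : q \is n.-1.+1.-homog by rewrite prednK ?dhomog_detpoly // ltnW.
pose t := rem i0 (enum 'I_n).
have pt : perm_eq (enum 'I_n) (rcons t i0).
  rewrite perm_sym perm_rcons perm_sym; apply: perm_to_rem; exact: mem_enum.
rewrite (mderiv_perm _ pt) foldr_rcons.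
have st : size t = n.-1 by rewrite size_rem ?mem_enum // size_enum_ord.
have -> : \prod_(1 <= d < n) gurvits C d = \prod_(1 <= d < (size t).+1) gurvits C d.
  by rewrite st prednK // ltnW.
apply: (@capacity_bound _ _ _ [:: i0]).
- by rewrite cats1 -(perm_uniq pt) enum_uniq.
- by move=> j; rewrite cats1 -(perm_mem pt) mem_enum.
- by rewrite st; apply: dhomog_mderiv.
- exact: strictly_stable_mderiv hq stq posq _.
- exact: positive_off_mderiv hq stq posq _.
- by rewrite mulr_ge0 ?gurvits_ge0.
move=> x xs xp; rewrite -(deriv_line0 _ xs).
have x0 j : 0 <= x j by have [/xs->|/xp/ltW] := boolP (j \in [:: i0]).
have [j0 j0i] : exists j0, j0 \notin [:: i0].
  have [e0i|e0i] := eqVneq i0 (Ordinal n1).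
    by exists (Ordinal (ltnW n1)); rewrite inE e0i.
  by exists (Ordinal n1); rewrite inE eq_sym.
pose X := \sum_(j | j != i0) x j *: B j.
have pX : psdmx X by apply: psdmx_comb.
have dX : \det X != 0.
  by apply: (posdef_comb (k := j0)) => //; [rewrite inE in j0i|exact: xp].
have lineB s : (line q i0 x).[s] = \det (X + s *: B i0).
  rewrite horner_line meval_detpoly (bigD1 i0) //= {1}/update eqxx addrC.
  by congr (\det (_ + _)); apply: eq_bigr => j /negPf ji; rewrite /update ji.
have [P [d [uP _ eX eA]]] := simultaneous_diag pX dX (pA i0).1.
have d0 : forall l, 0 <= d 0 l by apply: (psdmx_congr_diag uP); rewrite -eA.
(* [u] comes from the unperturbed singular matrix in slot [i0]: its degree is
   at most [n - 1], and the perturbation only increases the derivative. *)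
pose u : {poly C} := `|\det P| ^+ 2 *: \prod_l (1 + d 0 l *: 'X).
have uE s : u.[s] = \det (X + s *: A i0).
  rewrite -[X]scale1r eX eA det_pencil hornerZ horner_prod; congr (_ * _).
  by apply: eq_bigr => l _; rewrite !hornerE mulrC.
have [l0 dl0] : exists l0, d 0 l0 = 0.
  have /eqP := dA0; rewrite eA det_congr_diag mulf_eq0 gt_eqF ?normdet2_gt0 //=.
  by move=> /prodf_eq0[l0 _ /eqP]; exists l0.
have su : (size u <= n.-1.+1)%N.
  apply: leq_trans (size_scale_leq _ _) _.
  rewrite (bigD1 l0) //= dl0 scale0r addr0 mul1r.
  apply: leq_trans (size_prod_leq _ _) _; rewrite leq_subLR.
  have cl : #|[pred l : 'I_n | l != l0]| = n.-1.
    by rewrite cardC1 card_ord.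
  rewrite cl addnS ltnS; apply: (@leq_trans (\sum_(l < n | l != l0) 2)%N).
    apply: leq_sum => l _; apply: leq_trans (size_polyD _ _) _.
    by rewrite geq_max size_poly1 /= (leq_trans (size_scale_leq _ _)) // size_polyX.
  by rewrite sum_nat_const cl muln2 addnn.
rewrite mulrAC; apply: (@le_trans _ _ u^`().[0]).
  apply: gurvits_step => //.
  - by rewrite -ltnS prednK // ltnW.
  - by rewrite uE scale0r addr0 posdef_det_gt0.
  - move=> r; rewrite rootE hornerZ mulf_eq0 gt_eqF ?normdet2_gt0 //=.
    rewrite horner_prod => /prodf_eq0[l _]; rewrite !hornerE addr_eq0 => /eqP e1.
    have dl : 0 < d 0 l.
      rewrite lt_def d0 andbT; apply/negP => /eqP dl; move/eqP: e1.
      by rewrite dl mul0r oppr0 oner_eq0.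
    by rewrite -(pmulr_rlt0 _ dl) -oppr_gt0 -e1 ltr01.
  - by rewrite mulr_ge0 // prodr_ge0.
  - move=> s s0; rewrite uE.
    have up j : 0 < update x i0 s j.
      by rewrite /update; case: eqP => // /eqP ji; apply: xp; rewrite inE.
    have := capA _ up; rewrite (bigD1 i0) //= [\sum_j _](bigD1 i0) //=.
    have -> : update x i0 s i0 = s by rewrite /update eqxx.
    rewrite -mulrA [_ * s]mulrC.
    have -> : \prod_(j | j \notin [:: i0]) x j = \prod_(j | j != i0) update x i0 s j.
      by apply: eq_big => [j|j]; rewrite inE // /update => /negPf ->.
    move=> le_k; apply: le_trans le_k _.
    have -> : X + s *: A i0 = (s *: A i0 + \sum_(j | j != i0) update x i0 s j *: A j)
        + \sum_(j | j != i0) x j *: (e *: 1%:M).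
      rewrite addrC -addrA; congr (_ + _); rewrite -big_split /=.
      by apply: eq_bigr => j /negPf ji; rewrite /update ji -scalerDr.
    apply: le_det_psdmx.
      apply: psdmxD; first by apply: psdmxZ => //; exact: ltW.
      by apply: psdmx_comb => // j; rewrite /update; case: ifP => // _; apply: ltW.
    by apply: psdmx_comb => // j; apply: psdmxZ (psdmx1 _ _); exact: ltW.
apply: deriv0_le => [|s s0]; first by rewrite uE lineB !scale0r.
rewrite uE lineB /B /shift scalerDr addrA; apply: le_det_psdmx.
  by apply: psdmxD => //; apply: psdmxZ => //; exact: ltW.
by apply: psdmxZ; [exact: ltW|apply: psdmxZ (psdmx1 _ _); exact: ltW].
Qed.

End Pencils.

(** * Capacity of tuples with prescribed sum *)

Section ProductCapacity.
Variable R : realFieldType.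

(** Summation by parts, in the stronger form that bounds the weighted sum from
    below by the last weight times the plain sum. *)
Lemma abel_sum_ge0 (g e : nat -> R) m :
  (forall k, (k <= m)%N -> 0 <= g k) ->
  (forall k, (k < m)%N -> g k.+1 <= g k) ->
  (forall k, (k <= m.+1)%N -> 0 <= \sum_(j < k) e j) ->
  0 <= \sum_(j < m.+1) g j * e j.
Proof.
move=> g0 gm e0; apply: le_trans (_ : g m * \sum_(j < m.+1) e j <= _).
  by rewrite mulr_ge0 ?g0 ?e0.
elim: m g0 gm e0 => [|m IH] g0 gm e0; first by rewrite !big_ord1.
rewrite big_ord_recr [X in _ <= X]big_ord_recr /= mulrDr lerD2r.
apply: le_trans (IH _ _ _) => [|k km|k km|k km].
- by apply: ler_wpM2r; [apply: e0; rewrite ltnS|apply: gm].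
- by apply: g0; apply: leqW.
- by apply: gm; apply: leqW.
- by apply: e0; apply: leqW.
Qed.

Lemma sorting_perm n (f : 'I_n -> R) :
  exists s : {perm 'I_n}, forall i j : 'I_n, (i <= j)%N -> f (s i) <= f (s j).
Proof.
pose le_f i j := f i <= f j.
have le_f_tr : transitive le_f by move=> j i k; apply: le_trans.
have le_f_tot : total le_f by move=> i j; apply: le_total.
pose r := sort le_f (enum 'I_n).
have sr : size r = n by rewrite size_sort size_enum_ord.
have inj : injective (fun i : 'I_n => nth i r i).
  move=> i j; rewrite (set_nth_default j) ?sr // => /eqP.
  by rewrite nth_uniq ?sr ?sort_uniq ?enum_uniq // => /eqP/val_inj.
exists (perm inj) => i j ij; rewrite !permE (set_nth_default j) ?sr //.
have := sorted_leq_nth le_f_tr (fun _ => lexx _) j (sort_sorted le_f_tot (enum 'I_n)).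
by apply; rewrite // inE sr.
Qed.

(** The [k] smallest values of [y] dominate, up to the factor [1 - d], the
    [k] smallest values of [x]: each [y] is a mixture of the [x]'s and any [k]
    rows carry total weight at least [k - d].  Summation by parts then bounds
    the sum of the quotients of the sorted values, and AM-GM their product. *)
Lemma product_capacity n (a : 'I_n -> 'I_n -> R) (x : 'I_n -> R) d :
  (forall j l, 0 <= a j l) -> (forall l, \sum_j a j l = 1) ->
  (forall P : pred 'I_n, \sum_(j | P j) (1 - \sum_l a j l) <= d) -> d < 1 ->
  (forall l, 0 < x l) ->
  (1 - d) ^+ n * \prod_l x l <= \prod_j \sum_l a j l * x l.
Proof.
case: n a x => [|m] a x a0 col1 rowd d1 x0.
  by rewrite !big_ord0 expr0 mulr1.
have d0 : 0 <= d by have := rowd pred0; rewrite big_pred0_eq.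
pose y j := \sum_l a j l * x l.
have y_ge0 j : 0 <= y j by apply: sumr_ge0 => l _; rewrite mulr_ge0 // ltW.
have y0 j : 0 < y j.
  rewrite lt_def y_ge0 andbT; apply/negP => /eqP yj0.
  have aj l : a j l = 0.
    have /eqP := yj0; rewrite psumr_eq0 => [/allP/(_ l)|l' _]; last first.
      by rewrite mulr_ge0 // ltW.
    by rewrite mem_index_enum mulf_eq0 (gt_eqF (x0 l)) orbF => /(_ isT)/eqP.
  have := rowd (pred1 j); rewrite big_pred1_eq big1 => [|l _]; last exact: aj.
  by rewrite subr0 leNgt d1.
have [p yp] := sorting_perm y; have [r xr] := sorting_perm x.
pose e l : R := y (p (inord l)) - (1 - d) * x (r (inord l)).
pose g l : R := (y (p (inord l)))^-1.
have key : 0 <= \sum_(l < m.+1) g l * e l.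
  apply: abel_sum_ge0 => [k _|k km|k km].
  - by rewrite invr_ge0.
  - rewrite lef_pV2 ?posrE //; apply: yp; rewrite !inordK ?ltnS //; exact: ltnW.
  rewrite (big_ord_widen m.+1) //.
  pose S (l : 'I_m.+1) : bool := (l < k)%N.
  pose w l : R := \sum_(j | S j) a (p j) l.
  have w0 l : 0 <= w l by apply: sumr_ge0.
  have w1 l : w l <= 1.
    rewrite -(col1 l) (reindex_inj (@perm_inj _ p)) /= [X in _ <= X](bigID S) /=.
    by rewrite lerDl sumr_ge0.
  have sw : \sum_(l | S l) 1 - \sum_l w l <= d.
    have := rowd (fun j => S (p^-1%g j)); rewrite (reindex_inj (@perm_inj _ p)) /=.
    rewrite (eq_bigl S) => [|j]; last by rewrite permK.
    by rewrite sumrB [X in _ - X]exchange_big.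
  rewrite (eq_bigr (fun l => y (p l) - (1 - d) * x (r l))) => [|l _]; last first.
    by rewrite /e inord_val.
  rewrite sumrB -mulr_sumr subr_ge0.
  have -> : \sum_(l | S l) y (p l) = \sum_l w (r l) * x (r l).
    rewrite exchange_big (reindex_inj (@perm_inj _ r)) /=; apply: eq_bigr => l _.
    by rewrite mulr_suml.
  have sX0 : 0 <= \sum_(l | S l) x (r l) by apply: sumr_ge0 => l _; apply: ltW.
  case: k km @S w w0 w1 sw sX0 => [|k] km S w w0 w1 sw sX0.
    rewrite big_pred0 ?mulr0 => [|l]; last by rewrite /S ltn0.
    by apply: sumr_ge0 => l _; rewrite mulr_ge0 // ltW.
  pose th := x (r (inord k)).
  have thX : th <= \sum_(l | S l) x (r l).
    rewrite (bigD1 (inord k)) /=; last by rewrite /S inordK ?ltnS.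
    by rewrite lerDl sumr_ge0 // => l _; apply: ltW.
  (* [th], the largest of the [k + 1] smallest values, separates the indices
     with [w - 1 <= 0] from those with [0 <= w]. *)
  have : \sum_l (w (r l) - (S l)%:R) * th <= \sum_l (w (r l) - (S l)%:R) * x (r l).
    apply: ler_sum => l _; rewrite /S; case: ltnP => lk /=.
      apply: ler_wnM2l; first by rewrite subr_le0.
      by apply: xr; rewrite inordK ?ltnS // -ltnS.
    rewrite subr0; apply: ler_wpM2l => //.
    by apply: xr; rewrite inordK ?ltnS // ltnW.
  rewrite -mulr_suml.
  under [X in _ <= X]eq_bigr do rewrite mulrBl.
  rewrite !sumrB.
  have -> : \sum_l w (r l) = \sum_l w l by rewrite [RHS](reindex_inj (@perm_inj _ r)).
  have -> : \sum_l (S l)%:R * x (r l) = \sum_(l | S l) x (r l).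
    by rewrite [RHS]big_mkcond; apply: eq_bigr => l _; case: (S l); rewrite ?mul1r ?mul0r.
  have -> : \sum_l (S l)%:R = \sum_(l | S l) 1 :> R.
    by rewrite [RHS]big_mkcond; apply: eq_bigr => l _; case: (S l).
  have th0 : 0 < th by apply: x0.
  move: sw thX th0 d0; move: (\sum_l w l) (\sum_(l | S l) 1) => W N.
  move: (\sum_(l | S l) x (r l)) (\sum_l _ * _) => X Y.
  by move=> *; nra.
pose E l : R := (1 - d) * x (r l) / y (p l).
have E0 l : 0 <= E l by rewrite divr_ge0 ?mulr_ge0 ?subr_ge0 ?ltW.
have sE : \sum_l E l <= m.+1%:R.
  rewrite -subr_ge0; apply: le_trans key _; rewrite le_eqVlt; apply/orP; left.
  rewrite -[X in _ == X%:R - _](card_ord m.+1) -sumr_const -sumrB; apply/eqP.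
  apply: eq_bigr => l _; rewrite /g /e /E inord_val mulrBr mulVf ?gt_eqF //.
  by rewrite [_^-1 * _]mulrC.
have := @leif_AGM R 'I_m.+1 predT E; rewrite /= cardT size_enum_ord => /(_ _)[] => [l _|].
  exact: E0.
move=> AGM _; have : \prod_l E l <= 1.
  apply: le_trans AGM _; rewrite exprn_ile1 //.
    by rewrite divr_ge0 // sumr_ge0.
  by rewrite ler_pdivrMr ?ltr0Sn // mul1r.
rewrite prodf_div /= big_split /= prodr_const card_ord.
have <- : \prod_l x l = \prod_l x (r l) by rewrite (reindex_inj (@perm_inj _ r)).
have <- : \prod_l y l = \prod_l y (p l) by rewrite (reindex_inj (@perm_inj _ p)).
by rewrite ler_pdivrMr ?mul1r // prodr_gt0.
Qed.

End ProductCapacity.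

Lemma char_poly_congr (F : comUnitRingType) n (P A : 'M[F]_n) : P \in unitmx ->
  char_poly (invmx P *m A *m P) = char_poly A.
Proof.
move=> uP; rewrite /char_poly.
have -> : char_poly_mx (invmx P *m A *m P) =
    map_mx polyC (invmx P) *m char_poly_mx A *m map_mx polyC P.
  rewrite /char_poly_mx mulmxBr mulmxBl !map_mxM; congr (_ - _).
  by rewrite -mulmxA mul_scalar_mx -scalemxAr -map_mxM mulVmx // map_mx1 scalemx1.
rewrite !det_mulmx mulrAC -det_mulmx -map_mxM mulVmx // map_mx1 det1.
by rewrite mul1r.
Qed.

Lemma perm_eq_big_enum (T : eqType) (S : Type) (idx : S)
    (op : Monoid.com_law idx) (I : finType) (f g : I -> T) (F : T -> S) :
  perm_eq [seq f k | k <- enum I] [seq g k | k <- enum I] ->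
  \big[op/idx]_k F (f k) = \big[op/idx]_k F (g k).
Proof.
move=> pe; rewrite -big_enum -(big_map f predT F) (perm_big _ pe).
by rewrite big_map big_enum.
Qed.

Section Eigenvalues.
Local Open Scope sesquilinear_scope.
Local Open Scope complex_scope.
Variables (R : rcfType) (n : nat) (M : 'M[R[i]]_n) (c : 'rV[R]_n).
Hypotheses (pM : psdmx M) (eM : eigenvalues M c).

Lemma spectral_eigenvalues : exists V (l : 'rV[R[i]]_n),
  [/\ V \is unitarymx, forall k, 0 <= l 0 k, M = V^t* *m diag_mx l *m V
    & perm_eq [seq l 0 k | k <- enum 'I_n] [seq (c 0 k)%:C | k <- enum 'I_n]].
Proof.
have [V [l [uV l0 e]]] := psdmx_spectral pM; exists V, l; split=> //.
move: eM; rewrite /eigenvalues e -invmx_unitary // char_poly_congr ?unitarymx_unit //.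
rewrite char_poly_trig ?diag_mx_is_trig // => e'.
apply: prod_XsubC_eq; rewrite big_map big_enum [RHS]big_map [RHS]big_enum /= -e'.
by apply: eq_bigr => k _; rewrite mxE eqxx mulr1n.
Qed.

Lemma eigenvalues_ge0 k : 0 <= c 0 k.
Proof.
have [V [l [_ l0 _ /perm_mem pe]]] := spectral_eigenvalues.
have : (c 0 k)%:C \in [seq l 0 k | k <- enum 'I_n] by rewrite pe; apply: map_f; rewrite mem_enum.
by move=> /mapP[j _ e]; rewrite -lecR e l0.
Qed.

Lemma eigenvalues_det : \det M = (\prod_k c 0 k)%:C.
Proof.
have [V [l [uV _ e pe]]] := spectral_eigenvalues.
rewrite rmorph_prod e !det_mulmx mulrAC -det_mulmx -invmx_unitary //.
rewrite mulVmx ?unitarymx_unit // det1 mul1r det_diag.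
exact: (perm_eq_big_enum _ id pe).
Qed.

Lemma eigenvalues_tr : \tr M = (\sum_k c 0 k)%:C.
Proof.
have [V [l [uV _ e pe]]] := spectral_eigenvalues.
rewrite rmorph_sum e mxtrace_mulC mulmxA -invmx_unitary //.
rewrite mulmxV ?unitarymx_unit // mul1mx mxtrace_diag.
exact: (perm_eq_big_enum _ id pe).
Qed.

Hypothesis trM : \tr M = n%:R.

Lemma diag_deficit U (P : pred 'I_n) : U \is unitarymx ->
  \sum_(j | P j) (1 - (U *m M *m U^t*) j j) <= (norm1 (c - const_mx 1) / 2)%:C.
Proof.
move=> uU; have [V [l [uV l0 e pe]]] := spectral_eigenvalues.
have -> : (norm1 (c - const_mx 1) / 2)%:C = (\sum_k `|l 0 k - 1|) / 2.
  rewrite rmorphM fmorphV /= rmorph_nat; congr (_ / _); rewrite rmorph_sum.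
  rewrite [RHS](perm_eq_big_enum _ (fun t => `|t - 1|) pe); apply: eq_bigr => k _.
  rewrite !mxE -(rmorph1 (real_complex R)) -rmorphB /= normc_def /=.
  by rewrite expr0n addr0 sqrtr_sqr.
have -> : U *m M *m U^t* = (U *m V^t*) *m diag_mx l *m (U *m V^t*)^t*.
  by rewrite conjtmxM trmxCK e !mulmxA.
apply: unitary_diag_deficit => [|k|].
- by apply: mul_unitarymx; [exact: uU|rewrite trmxC_unitary].
- exact: ger0_real.
- rewrite -trM e mxtrace_mulC mulmxA -invmx_unitary //.
  by rewrite mulmxV ?unitarymx_unit // mul1mx mxtrace_diag.
Qed.

(** In an eigenbasis of [\sum_l x_l A_l] the determinant is a product of
    linear forms in [x], to which [product_capacity] applies. *)
Lemma det_capacity (A : {ffun 'I_n -> 'M[R[i]]_n}) (x : 'I_n -> R[i]) :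
  MatTup M A -> norm1 (c - const_mx 1) < 2 -> (forall l, 0 < x l) ->
  ((1 - norm1 (c - const_mx 1) / 2) ^+ n)%:C * \prod_l x l <=
    \det (\sum_l x l *: A l).
Proof.
move=> [pA sA] c2 x0; set d := _ / 2.
have pX : psdmx (\sum_l x l *: A l).
  by apply: psdmx_sum => l _; apply: psdmxZ; [exact: ltW|exact: (pA l).1].
have [U [y [uU y0 eX]]] := psdmx_spectral pX.
pose B l := U *m A l *m U^t*.
have pB l : psdmx (B l) by have := congr_psdmx (U^t*) (pA l).1; rewrite trmxCK.
have UV : U *m U^t* = 1%:M by apply/unitarymxP.
have yE j : y 0 j = \sum_l B l j j * x l.
  have : U *m (\sum_l x l *: A l) *m U^t* = diag_mx y.
    by rewrite eX !mulmxA UV mul1mx -mulmxA UV mulmx1.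
  move=> /matrixP /(_ j j); rewrite [RHS]mxE eqxx mulr1n => <-.
  rewrite mulmx_sumr mulmx_suml summxE; apply: eq_bigr => l _.
  by rewrite -scalemxAr -scalemxAl mxE mulrC.
pose a j l := complex.Re (B l j j); pose xR l := complex.Re (x l).
have aE j l : (a j l)%:C = B l j j.
  by apply: RRe_real; apply: ger0_real; exact: psdmx_diag_ge0 (pB l).
have xE l : (xR l)%:C = x l by rewrite RRe_real // gtr0_real.
have -> : \det (\sum_l x l *: A l) = (\prod_j \sum_l a j l * xR l)%:C.
  rewrite eX !det_mulmx mulrAC -det_mulmx -invmx_unitary //.
  rewrite mulVmx ?unitarymx_unit // det1 mul1r det_diag rmorph_prod.
  apply: eq_bigr => j _; rewrite yE rmorph_sum; apply: eq_bigr => l _.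
  by rewrite -aE -[x l]xE [RHS]rmorphM.
have -> : \prod_l x l = (\prod_l xR l)%:C.
  by rewrite rmorph_prod; apply: eq_bigr => l _; rewrite -[LHS]xE.
rewrite -rmorphM lecR; apply: product_capacity.
- by move=> j l; rewrite -lecR aE; exact: psdmx_diag_ge0 (pB l).
- move=> l; apply: complexI; rewrite rmorph_sum rmorph1.
  rewrite -(pA l).2 -[X in \tr X](mul1mx (A l)) -[X in X *m A l](mulmx1C UV).
  rewrite -mulmxA mxtrace_mulC; apply: eq_bigr => j _; exact: aE.
- move=> P; rewrite -lecR rmorph_sum; apply: le_trans (diag_deficit P uU).
  rewrite le_eqVlt; apply/orP; left; apply/eqP; apply: eq_bigr => j _.
  rewrite rmorphB rmorph1 rmorph_sum; congr (_ - _).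
  rewrite -sA mulmx_sumr mulmx_suml summxE; apply: eq_bigr => l _; exact: aE.
- by rewrite /d ltr_pdivrMr // mul1r.
- by move=> l; rewrite -ltcR xE.
Qed.

End Eigenvalues.

(** * The exchange argument *)

Section Exchange.
Variables (C : numClosedFieldType) (n : nat).
Implicit Types (A B : {ffun 'I_n -> 'M[C]_n}) (X Y M : 'M[C]_n) (i j l : 'I_n).

Lemma psdmx_segment X Y s t : psdmx X -> psdmx (X + t *: Y) -> 0 <= s -> s <= t ->
  0 < t -> psdmx (X + s *: Y).
Proof.
move=> pX pXY s0 st t0.
have -> : X + s *: Y = (1 - s / t) *: X + (s / t) *: (X + t *: Y).
  rewrite scalerDr scalerA divfK ?gt_eqF // addrA -scalerDl subrK scale1r //.
apply: psdmxD; apply: psdmxZ => //; last by rewrite divr_ge0 // ltW.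
by rewrite subr_ge0 ler_pdivrMr // mul1r.
Qed.

Lemma pos_min2 (a b : C) : 0 < a -> 0 < b ->
  exists c, [/\ 0 < c, c <= a, c <= b & c = a \/ c = b].
Proof.
move=> a0 b0; case: (real_leP (gtr0_real a0) (gtr0_real b0)) => [ab|/ltW ba].
  by exists a; split=> //; left.
by exists b; split=> //; right.
Qed.

(** [s] units of the difference are transferred from slot [j] to slot [i];
    [s = 0] gives back [B] and [s = 1] exchanges the two slots. *)
Definition transfer B i j s : {ffun 'I_n -> 'M[C]_n} :=
  [ffun l => update_mx (update_mx B i (B i + s *: (B j - B i))) j
                       (B j - s *: (B j - B i)) l].

Lemma transfer_l B i j s : i != j -> transfer B i j s i = B i + s *: (B j - B i).
Proof. by move=> ij; rewrite ffunE /update_mx (negPf ij) eqxx. Qed.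

Lemma transfer_r B i j s : transfer B i j s j = B j - s *: (B j - B i).
Proof. by rewrite ffunE /update_mx eqxx. Qed.

Lemma transfer_o B i j s l : l != i -> l != j -> transfer B i j s l = B l.
Proof. by move=> li lj; rewrite ffunE /update_mx (negPf li) (negPf lj). Qed.

Lemma transfer_MatTup M B i j s : i != j -> MatTup M B ->
  psdmx (B i + s *: (B j - B i)) -> psdmx (B j - s *: (B j - B i)) ->
  MatTup M (transfer B i j s).
Proof.
move=> ij [pB sB] pi pj; split=> [l|].
  have tH : \tr (s *: (B j - B i)) = 0.
    by rewrite mxtraceZ linearB /= (pB i).2 (pB j).2 subrr mulr0.
  have [->|lj] := eqVneq l j.
    by rewrite transfer_r; split=> //; rewrite linearB /= tH subr0 (pB j).2.
  have [->|li] := eqVneq l i.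
    by rewrite transfer_l //; split=> //; rewrite linearD /= tH addr0 (pB i).2.
  by rewrite transfer_o.
rewrite -sB (bigD1 j) // [RHS](bigD1 j) //= (bigD1 i) // [in RHS](bigD1 i) //=.
rewrite transfer_r transfer_l // !addrA; congr (_ + _).
  by rewrite addrAC subrK.
by apply: eq_bigr => l /andP[lj li]; rewrite transfer_o.
Qed.

(** Multilinearity gives a quadratic in [s]; exchanging the two slots shows
    that it is symmetric about [1 / 2]. *)
Lemma mixdet_transfer B i j : i != j -> exists K, forall s,
  mixdet (transfer B i j s) = mixdet B + (s - s ^+ 2) * K.
Proof.
move=> ij; pose D X Y := mixdet (update_mx (update_mx B i X) j Y).
have DC X Y : D X Y = D Y X.
  rewrite /D -(mixdet_perm _ (tperm i j)); apply: eq_mixdet => l /=.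
  rewrite /update_mx; case: tpermP => [->|->|]; rewrite ?eqxx ?(negPf ij) //.
  by move=> /eqP/negPf-> /eqP/negPf->.
have Dr X a b Y Z : D X (a *: Y + b *: Z) = a * D X Y + b * D X Z.
  exact: mixdet_linear.
have Dl X a b Y Z : D (a *: Y + b *: Z) X = a * D Y X + b * D Z X.
  by rewrite DC Dr ![D X _]DC.
have D0 : D (B i) (B j) = mixdet B.
  apply: eq_mixdet => l; rewrite /update_mx.
  by case: eqP => [->//|_]; case: eqP => [->|].
exists (D (B i) (B i) + D (B j) (B j) - 2 * D (B i) (B j)) => s.
have -> : mixdet (transfer B i j s) =
    D ((1 - s) *: B i + s *: B j) ((1 - s) *: B j + s *: B i).
  apply: eq_mixdet => l; rewrite ffunE /update_mx.
  case: eqP => _; first by rewrite scalerBl scale1r scalerBr opprB addrA addrAC.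
  case: eqP => // _; first by rewrite scalerBl scale1r scalerBr addrA addrAC.
rewrite Dl !Dr (DC (B j) (B i)) -D0; ring.
Qed.

(** At a minimum all of whose matrices are nonsingular, the mixed discriminant
    is constant along every exchange line: the line can be followed a little
    in both directions, and a quadratic taking equal values at [0] and [1] has
    its critical point at [1/2].  Following the line up to the boundary of the
    cone then contradicts the assumption on singular tuples. *)
Lemma minimizer_constant M B : MatTup M B ->
  (forall A, MatTup M A -> mixdet B <= mixdet A) ->
  (forall A l, MatTup M A -> \det (A l) = 0 -> mixdet B < mixdet A) ->
  forall i j, B i = B j.
Proof.
move=> BM minB sing i j; apply/eqP; apply: contraT => nij.
have ij : i != j by apply: contraNneq nij => ->.
have dB l : \det (B l) != 0.
  by apply/negP => /eqP/(sing _ _ BM); rewrite ltxx.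
have [pB _] := BM.
set H := B j - B i.
have trH : \tr H = 0 by rewrite linearB /= (pB i).2 (pB j).2 subrr.
have hH : H \is hermsymmx by apply: hermsymmxB; [exact: (pB j).1.1|exact: (pB i).1.1].
have H0 : H != 0 by rewrite subr_eq0 eq_sym.
have npH : ~ psdmx H by move=> /psdmx_tr0 /(_ trH) /eqP; rewrite (negPf H0).
have hN : - H \is hermsymmx by rewrite -scaleN1r hermsymmxZ // realN real1.
have npN : ~ psdmx (- H).
  move=> /psdmx_tr0; rewrite linearN /= trH oppr0 => /(_ erefl) /eqP.
  by rewrite oppr_eq0 (negPf H0).
have [s1 [s10 ps1 ds1]] := psdmx_exit (pB i).1 (dB i) hH npH.
have [s2 [s20 ps2 ds2]] := psdmx_exit (pB j).1 (dB j) hN npN.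
have [s3 [s30 ps3 _]] := psdmx_exit (pB i).1 (dB i) hN npN.
have [s4 [s40 ps4 _]] := psdmx_exit (pB j).1 (dB j) hH npH.
have [K eK] := mixdet_transfer B ij.
have [s [s0 ss1 ss2 s12]] := pos_min2 s10 s20.
have [u [u0 us3 us4 _]] := pos_min2 s30 s40.
have [w [w0 ws wu _]] := pos_min2 s0 u0.
have h0 : 0 < 2^-1 :> C by rewrite invr_gt0 ltr0n.
have [t [t0 tw t2 _]] := pos_min2 w0 h0.
have fwd x : 0 <= x -> x <= s -> MatTup M (transfer B i j x).
  move=> x0 xs; apply: transfer_MatTup => //.
    by apply: (psdmx_segment (pB i).1 ps1) => //; apply: le_trans ss1.
  by rewrite -scalerN; apply: (psdmx_segment (pB j).1 ps2) => //; apply: le_trans ss2.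
have bwd x : 0 <= x -> x <= u -> MatTup M (transfer B i j (- x)).
  move=> x0 xs; apply: transfer_MatTup => //.
    rewrite scaleNr -scalerN.
    by apply: (psdmx_segment (pB i).1 ps3) => //; apply: le_trans us3.
  rewrite scaleNr opprK.
  by apply: (psdmx_segment (pB j).1 ps4) => //; apply: le_trans us4.
have t1 : t < 1 by apply: le_lt_trans t2 _; rewrite invf_lt1 ?ltr0n // ltr1n.
have Kge : 0 <= K.
  have := minB _ (fwd t (ltW t0) (le_trans tw ws)); rewrite eK lerDl.
  by rewrite pmulr_rge0 // subr_gt0 expr2 gtr_pMr.
have Kle : K <= 0.
  have := minB _ (bwd t (ltW t0) (le_trans tw wu)); rewrite eK lerDl.
  by rewrite nmulr_rge0 // sqrrN -opprD oppr_lt0 addr_gt0 // exprn_gt0.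
have K0 : K = 0 by apply: le_anti; rewrite Kge Kle.
have sM := fwd s (ltW s0) (lexx _).
have : mixdet (transfer B i j s) = mixdet B by rewrite eK K0 mulr0 addr0.
case: s12 => es.
- by have := sing _ i sM; rewrite transfer_l // es => /(_ ds1) + e; rewrite e ltxx.
- have := sing _ j sM; rewrite transfer_r es -scalerN => /(_ ds2) + e.
  by rewrite e ltxx.
Qed.

Lemma MatTup_center M : (0 < n)%N -> psdmx M -> \tr M = n%:R ->
  MatTup M [ffun => n%:R^-1 *: M].
Proof.
move=> n0 pM tM; have nn : n%:R != 0 :> C by rewrite pnatr_eq0 -lt0n.
split=> [l|]; first rewrite ffunE; first split.
- by apply: psdmxZ; rewrite ?invr_ge0.
- by rewrite mxtraceZ tM mulVf.
- under eq_bigr do rewrite ffunE.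
  by rewrite sumr_const card_ord -scaler_nat scalerA mulfV // scale1r.
Qed.

Lemma constant_center M B : (0 < n)%N -> MatTup M B ->
  (forall i j, B i = B j) -> B = [ffun => n%:R^-1 *: M].
Proof.
move=> n0 [_ sB] cB; have nn : n%:R != 0 :> C by rewrite pnatr_eq0 -lt0n.
apply/ffunP => i; rewrite ffunE -sB (eq_bigr (fun _ => B i)) => [|j _ //].
by rewrite sumr_const card_ord -scaler_nat scalerA mulVf // scale1r.
Qed.

End Exchange.

Lemma MD_unique_min (C : numClosedFieldType) n (M : 'M[C]_n) : (0 < n)%N ->
  psdmx M -> \tr M = n%:R ->
  (exists2 A : {ffun 'I_n -> 'M[C]_n}, MatTup M A &
     forall B : {ffun 'I_n -> 'M[C]_n}, MatTup M B -> mixdet A <= mixdet B) ->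
  (forall (A : {ffun 'I_n -> 'M[C]_n}) l, MatTup M A -> \det (A l) = 0 ->
     mixdet (fun _ : 'I_n => n%:R^-1 *: M) < mixdet A) ->
  uniquely_minimized_at (@MD C n) (MatTup M) [ffun => n%:R^-1 *: M].
Proof.
move=> n0 pM tM [B BM minB] sing; have cM := MatTup_center n0 pM tM.
set c0 := [ffun => _] in cM *.
have ec : mixdet c0 = mixdet (fun _ : 'I_n => n%:R^-1 *: M).
  by apply: eq_mixdet => l; rewrite ffunE.
have uniq A : MatTup M A -> mixdet A <= mixdet B -> A = c0.
  move=> AM leA; apply: constant_center => //; apply: (minimizer_constant AM).
    by move=> X /minB; apply: le_trans.
  move=> X l XM /(sing _ _ XM); apply: le_lt_trans; rewrite -ec.
  exact: le_trans leA (minB _ cM).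
have eB : B = c0 by apply: uniq.
have f0 : 0 < (n`!%:R)^-1 :> C by rewrite invr_gt0 ltr0n fact_gt0.
split; first exact: cM.
- by move=> A AM; rewrite !MDE ler_pM2l // -eB minB.
- move=> A AM; rewrite !MDE => /(mulfI (lt0r_neq0 f0)) e.
  by apply: uniq => //; rewrite e eB.
Qed.

(** * The numerical threshold *)

Section Constants.
Variable R : realFieldType.

Lemma gurvits_gt0 d : 0 < gurvits R d.+1.
Proof.
case: d => [|d]; first by rewrite /gurvits expr0 ltr01.
by rewrite exprn_gt0 // divr_gt0 ?ltr0Sn.
Qed.

Lemma prod_gurvits n : \prod_(1 <= d < n.+1) gurvits R d = n`!%:R / n%:R ^+ n.
Proof.
elim: n => [|n IH]; first by rewrite big_geq // expr0 divr1.
rewrite big_nat_recr //= IH /gurvits /= factS natrM.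
case: n {IH} => [|n]; first by rewrite fact0 !expr0 expr1 !divr1 !mulr1.
have n1 : n.+1%:R != 0 :> R by rewrite pnatr_eq0.
have n2 : n.+2%:R != 0 :> R by rewrite pnatr_eq0.
rewrite expr_div_n mulrA divfK ?expf_neq0 // [n.+2%:R ^+ n.+2]exprS.
by rewrite -mulf_div divff // mul1r.
Qed.

(** The threshold of the criterion is what is gained when one variable has
    degree [n - 1] instead of [n]. *)
Lemma gurvits_ratio n : (2 <= n)%N ->
  (n - 1)%:R ^+ (2 * n - 3) / (n%:R ^+ (n - 1) * (n - 2)%:R ^+ (n - 2)) =
  gurvits R n / gurvits R n.-1.
Proof.
case: n => [|[|m]] // _; rewrite subn1 subn2 /= /gurvits /=.
have -> : (2 * m.+2 - 3 = m.+1 + m)%N by rewrite mul2n -addnn !addnS !addSn !subSS subn0.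
rewrite !expr_div_n invf_div exprD mulf_div.
by rewrite [_ * _ ^+ m in RHS]mulrC [X in _ = X / _]mulrC.
Qed.

Lemma bernoulli_le n (x : R) : x <= 1 -> 1 - n%:R * x <= (1 - x) ^+ n.
Proof.
move=> x1; elim: n => [|n IH]; first by rewrite mul0r subr0 expr0.
rewrite exprS; apply: le_trans (_ : (1 - x) * (1 - n%:R * x) <= _).
  rewrite -natr1; have n0 : 0 <= n%:R :> R by []; move: (n%:R : R) n0 => N N0; nra.
by rewrite ler_wpM2l // subr_ge0.
Qed.

(** With [N = n - 1] the claim reads [(N - 1) / N < (1 - 1 / N ^ 2) ^ N]; this is
    Bernoulli's inequality, made strict by splitting off one factor. *)
Lemma gurvits_decreasing n : (2 <= n)%N -> gurvits R n < gurvits R n.-1.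
Proof.
case: n => [|[|[|m]]] // _; first by rewrite /gurvits /= expr0 expr1; lra.
rewrite /gurvits /=; set N : R := m.+2%:R.
have -> : m.+3%:R = N + 1 :> R by rewrite /N natr1.
have -> : m.+1%:R = N - 1 :> R by rewrite /N -[m.+2%:R]natr1 addrK.
have N1 : 1 < N by rewrite /N ltr1n.
pose x : R := (N ^+ 2)^-1.
have N0 : 0 < N by lra.
have xN : x * N ^+ 2 = 1 by rewrite mulVf // expf_neq0 // gt_eqF.
have x0 : 0 < x by rewrite invr_gt0 exprn_gt0.
have x1 : x < 1 by rewrite invf_lt1 ?exprn_gt0 // exprn_egt1.
have key : (N - 1) / N < (1 - x) ^+ m.+2.
  rewrite exprS; apply: lt_le_trans (_ : (1 - x) * (1 - m.+1%:R * x) <= _).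
    have -> : (N - 1) / N = 1 - N * x.
      rewrite mulrBl mul1r divff ?gt_eqF // /x expr2 invfM mulrA divff ?gt_eqF //.
      by rewrite mul1r.
    have -> : m.+1%:R = N - 1 :> R by rewrite /N -[m.+2%:R]natr1 addrK.
    by nra.
  by rewrite ler_wpM2l ?bernoulli_le ?subr_ge0 // ltW.
have e1 : 1 - x = (N - 1) / N * ((N + 1) / N).
  by rewrite /x; move: (N) (gt_eqF N0) => L /negbT L0; field.
move: key; rewrite e1 exprMn exprS -mulrA.
have q0 : 0 < (N - 1) / N by rewrite divr_gt0 // subr_gt0.
rewrite -{1}[(N - 1) / N]mulr1 ltr_pM2l // => key.
have p0 : 0 < ((N + 1) / N) ^+ m.+2 by rewrite exprn_gt0 // divr_gt0 // addr_gt0 ?ltr01.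
have -> : N / (N + 1) = ((N + 1) / N)^-1 by rewrite invf_div.
by rewrite exprVn -div1r ltr_pdivrMr.
Qed.

End Constants.

(** After cancelling the product of the [gurvits k] for [k < n], the criterion is
    the comparison of the lower bound for singular tuples with the value at the
    centre. *)
Lemma singular_gt_center (R : realType) n (M : 'M[R[i]]_n) (c : 'rV[R]_n) :
  (2 <= n)%N -> psdmx M -> eigenvalues M c -> \tr M = n%:R ->
  norm1 (c - const_mx 1) < 2 ->
  gurvits R n / gurvits R n.-1 <
    (\prod_(i < n) c ord0 i)^-1 * (1 - norm1 (c - const_mx 1) / 2) ^+ n ->
  forall (A : {ffun 'I_n -> 'M[R[i]]_n}) l, MatTup M A -> \det (A l) = 0 ->
     mixdet (F := (R[i] : numClosedFieldType)) (fun _ : 'I_n => n%:R^-1 *: M) <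
     mixdet (F := (R[i] : numClosedFieldType)) A.
Proof.
move=> n2 pM eM tM c2 hr A l AM dA.
set d := _ / 2 in hr; set P := \prod_(i < n) _ in hr.
have P0 : 0 <= P by apply: prodr_ge0 => k _; exact: eigenvalues_ge0 pM eM k.
have [m en] : exists m, n = m.+2 by case: (n) n2 => [|[|m]] // _; exists m.
have gn : 0 < gurvits R n by rewrite en gurvits_gt0.
have gn1 : 0 < gurvits R n.-1 by rewrite en gurvits_gt0.
have Pgt : 0 < P.
  rewrite lt_def P0 andbT; apply: contraTneq hr => ->.
  by rewrite invr0 mul0r -leNgt divr_ge0 // ltW.
have d1 : 0 <= 1 - d by rewrite subr_ge0 ler_pdivrMr // mul1r ltW.
have low := @mixdet_singular_ge _ _ A l ((1 - d) ^+ n)%:C%C n2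
  (fun j => (AM.1 j).1) dA _ (fun x x0 => det_capacity pM eM tM AM c2 x0).
apply: lt_le_trans (low _); last by rewrite -(rmorph0 (real_complex R)) lecR exprn_ge0.
rewrite mixdet_const detZ (eigenvalues_det pM eM).
have gC k : gurvits R[i] k = (gurvits R k)%:C%C.
  by rewrite /gurvits rmorphXn fmorph_div !rmorph_nat.
rewrite gC (eq_bigr _ (fun k _ => gC k)) -rmorph_prod -!rmorphM.
have -> : n`!%:R * (n%:R^-1 ^+ n * P%:C%C) =
    (n`!%:R / n%:R ^+ n * P)%:C%C :> R[i].
  by rewrite !rmorphM fmorphV rmorphXn !rmorph_nat exprVn mulrA.
rewrite ltcR -prod_gurvits big_nat_recr /=; last by rewrite en.
set Q := \prod_(1 <= k < n) _.
have Q0 : 0 < Q.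
  rewrite /Q big_seq prodr_gt0 // => k; rewrite mem_index_iota => /andP[k1 _].
  by case: k k1 => // k _; apply: gurvits_gt0.
rewrite -[X in X < _]mulrA [Q * _]mulrC ltr_pM2r //; move: hr.
by rewrite ltr_pdivrMr // -mulrA [P^-1 * _]mulrC ltr_pdivlMr.
Qed.

Lemma unique_min_of_ratio (R : realType) n (M : 'M[R[i]]_n) (c : 'rV[R]_n) :
  (2 <= n)%N -> psdmx M -> eigenvalues M c -> \tr M = n%:R ->
  norm1 (c - const_mx 1) < 2 ->
  gurvits R n / gurvits R n.-1 <
    (\prod_(i < n) c ord0 i)^-1 * (1 - norm1 (c - const_mx 1) / 2) ^+ n ->
  uniquely_minimized_at (@MD R[i] n) (MatTup M) [ffun => n%:R^-1 *: M].
Proof.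
move=> n2 pM eM tM c2 hr; have n0 : (0 < n)%N by apply: ltnW.
apply: (@MD_unique_min R[i]) => //.
  apply: (Compactness.minimizer_exists (MatTup_center n0 pM tM)).
  by move=> A [pA _]; apply: (mixdet_ge0 n0) => l; exact: (pA l).1.
exact: singular_gt_center pM eM tM c2 hr.
Qed.

(** For [n <= 1] the tuple is determined by its sum. *)
Lemma unique_min_small (R : realType) n (M : 'M[R[i]]_n) : (n < 2)%N ->
  psdmx M -> \tr M = n%:R ->
  uniquely_minimized_at (@MD R[i] n) (MatTup M) [ffun => n%:R^-1 *: M].
Proof.
move=> n2 pM tM.
have cM : MatTup M [ffun => n%:R^-1 *: M].
  case: n n2 M pM tM => [|n] n2 M pM tM; last exact: MatTup_center.
  split=> [[]//|]; rewrite big_ord0; by apply/matrixP => -[].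
have uniq A : MatTup M A -> A = [ffun => n%:R^-1 *: M].
  case: n n2 M pM tM A {cM} => [|[|//]] _ M pM tM A AM; first by apply/ffunP => -[].
  by apply: constant_center AM _ => // i j; rewrite !ord1.
split=> [//|A /uniq -> //|A /uniq -> //].
Qed.

Section Threshold.
Variables (R : rcfType) (n : nat) (M : 'M[R[i]]_n) (c : 'rV[R]_n).
Hypotheses (n2 : (2 <= n)%N) (pM : psdmx M) (eM : eigenvalues M c)
  (tM : \tr M = n%:R).

Lemma eigenvalues_prod_le1 : \prod_(i < n) c ord0 i <= 1.
Proof.
have sc : \sum_(i < n) c ord0 i = n%:R.
  by apply: complexI; rewrite -(eigenvalues_tr pM eM) tM rmorph_nat.
have := @leif_AGM R 'I_n predT (fun i => c ord0 i); rewrite /= cardT size_enum_ord.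
move=> /(_ _)[] => [k _|]; first exact: eigenvalues_ge0 pM eM k.
move=> AGM _; apply: le_trans AGM _; rewrite sc divff ?expr1n //.
by rewrite pnatr_eq0 -lt0n ltnW.
Qed.

Lemma eigenvalues_prod_gt0 : norm1 (c - const_mx 1) < 1 ->
  0 < \prod_(i < n) c ord0 i.
Proof.
move=> c1; apply: prodr_gt0 => k _.
have : `|c ord0 k - 1| < 1.
  apply: le_lt_trans c1; rewrite /norm1 (bigD1 k) //= !mxE lerDl.
  by rewrite sumr_ge0.
by rewrite ltr_norml => /andP[]; lra.
Qed.

End Threshold.

Theorem theorem4p1 (R : realType) :
  (forall n : nat, exists2 eps : R, 0 < eps &
     forall (C : 'M[R[i]]_n) (c : 'rV[R]_n),
       psdmx C -> eigenvalues C c -> \tr C = n%:R ->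
       norm1 (c - const_mx 1) < eps ->
       uniquely_minimized_at (@MD R[i] n) (MatTup C)
         [ffun => n%:R^-1 *: C])
  /\
  (forall (n : nat) (C : 'M[R[i]]_n) (c : 'rV[R]_n), (2 <= n)%N ->
     psdmx C -> eigenvalues C c -> \tr C = n%:R ->
     norm1 (c - const_mx 1) < 2 ->
     (n - 1)%:R ^+ (2 * n - 3) / (n%:R ^+ (n - 1) * (n - 2)%:R ^+ (n - 2))
       < (\prod_(i < n) c ord0 i)^-1 * (1 - norm1 (c - const_mx 1) / 2) ^+ n ->
     uniquely_minimized_at (@MD R[i] n) (MatTup C)
       [ffun => n%:R^-1 *: C]).
Proof.
split=> [n|n C c n2 pC eC tC c2]; last first.
  move=> hr; apply: (unique_min_of_ratio n2 pC eC tC c2).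
  by rewrite -(gurvits_ratio R n2).
have [n2|n2] := ltnP n 2.
  exists 1; first exact: ltr01.
  by move=> C c pC _ tC _; apply: (unique_min_small n2 pC tC).
pose r := gurvits R n / gurvits R n.-1.
have g1 : 0 < gurvits R n.-1 by case: (n) n2 => [|[|m]] // _; apply: gurvits_gt0.
have r1 : r < 1 by rewrite ltr_pdivrMr // mul1r gurvits_decreasing.
have r0 : 0 <= r by rewrite divr_ge0 ?gurvits_ge0.
have n0 : 0 < n%:R :> R by rewrite ltr0n ltnW.
have n1 : 1 <= n%:R :> R by rewrite ler1n ltnW.
exists ((1 - r) / n%:R) => [|C c pC eC tC hd].
  by rewrite divr_gt0 // subr_gt0.
have e1 : (1 - r) / n%:R <= 1 by rewrite ler_pdivrMr // mul1r; lra.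
have hd' : norm1 (c - const_mx 1) * n%:R < 1 - r by rewrite -ltr_pdivlMr.
have c1 := lt_le_trans hd e1; have P0 := eigenvalues_prod_gt0 c1.
have d0 : 0 <= norm1 (c - const_mx 1) by apply: sumr_ge0.
have c2 : norm1 (c - const_mx 1) < 2 by apply: lt_trans c1 _; rewrite ltr1n.
apply: (unique_min_of_ratio n2 pC eC tC c2); rewrite -/r.
 set d := norm1 _ in hd hd' c1 d0 *.
apply: lt_le_trans (_ : (1 - d / 2) ^+ n <= _).
  apply: lt_le_trans (bernoulli_le n _); last by lra.
  by rewrite mulrA [n%:R * d]mulrC; lra.
rewrite ler_peMl ?exprn_ge0 //; first by lra.
by rewrite invf_ge1 // (eigenvalues_prod_le1 n2 pC eC tC).
Qed.
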